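(* Let $\lambda>0$ and $t\ge0$. For every $n\ge 1$, $$\mathcal{R}(t,n,\lambda)= \begin{cases} \displaystyle \sum_{i=1}^n \gamma_{n,i} \, e^{-\lambda\sum_{j=1}^i F(j)\, t}&\text{ if } \displaystyle \sum_{j=1}^n F(j)>0,\\ n& \text{ otherwise, } \end{cases}$$ where the constants $\gamma_{n,i}$, $1\le i\le n$, are computed recursively according to $$\gamma_{n,n}= n -\sum_{i=1}^{n-1} \gamma_{n,i} \quad\text{and}\quad\gamma_{n,i}= 2 \cdot \frac{\sum_{j=1}^{n-i}F(j)\, \gamma_{n-j,i}}{\sum_{k=i+1}^{n}F(k)}, \quad 1 \leq i < n,$$ with boundary values $\gamma_{i,j}=1$ for all $i,j$ such that $F(i)=0$ and $j\leq i$ (these boundary values replace the recursion for those first indices $i$ with $F(i)=0$). Furthermore, for $n\ge m$, $$\mathcal{C}(t,n,\lambda)=n- \sum_{i=1}^{n-1} \tilde\gamma_{n,i}\,e^{-\lambda\sum_{j=1}^i F(j)\, t}-\tilde \gamma_{n,n}\,e^{-\lambda nt},$$ where $$\tilde \gamma_{n,i}=\sum_{k=1}^{n-i}f(k)\frac{\gamma_{n-k,i}}{1-\frac{1}{n}\sum_{j=1}^i F(j)}\quad (1\le i\le n-1)\qquad\text{ and }\qquad\tilde \gamma_{n,n}=n-\sum_{i=1}^{n-1}\tilde \gamma_{n,i}.$$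
   Context: Discrete sequential packing. Fix $m\in\mathbb{N}_+$ and a probability distribution supported on $\{1,\dots,m\}$ (the bundle size distribution), with mass function $f(k)=P(B=k)$ and distribution function $F(k)=P(B\le k)$. Line model: there are $n$ packages at locations $1,\dots,n$ on a line, all available at time $0$. To each location $i$ is attached a Poisson process of rate $\lambda>0$; the processes at different locations are independent, and each point of each process carries a mark (bundle size); all marks are i.i.d. with distribution $F$ and independent of all the Poisson processes. A point of the process at location $i$ with mark $k$ is a request for the packages at locations $i,i+1,\dots,i+k-1$. The request is accepted if $i+k-1\le n$ and all these packages are still available at that time, in which case all $k$ of them are picked up (removed permanently); otherwise it is rejected and nothing changes. $\mathcal{K}(t,n,\lambda)$ denotes the expected number of packages picked up during $[0,t]$, and $\mathcal{R}(t,n,\lambda)=n-\mathcal{K}(t,n,\lambda)$. Circle model: the same, except that the $n$ locations are arranged on a circle (locations are taken modulo $n$), and a request of size $k$ at $i$ is accepted if $k\le n$ and the packages at $i,i+1,\dots,i+k-1$ (modulo $n$) are all available. $\mathcal{C}(t,n,\lambda)$ denotes the expected number of packages picked up during $[0,t]$ in the circle model. *)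

(* Defs.v *)
From HB Require Import structures.
From mathcomp Require Import all_boot all_order all_algebra finmap.
From mathcomp Require Import all_classical all_reals all_analysis.

Set Implicit Arguments.
Unset Strict Implicit.
Unset Printing Implicit Defensive.

Import Order.TTheory GRing.Theory Num.Theory.
Import numFieldNormedType.Exports.

Local Open Scope classical_set_scope.
Local Open Scope ring_scope.

Section bundle_size.
Context {R : realType}.
Implicit Types f : nat -> R.

Definition is_size_pmf (m : nat) f : Prop :=
  [/\ forall k, 0 <= f k,
      forall k, ~~ (1 <= k <= m)%N -> f k = 0 &
      \sum_(1 <= k < m.+1) f k = 1].

Definition size_cdf f (k : nat) : R := \sum_(j < k.+1) f j.

End bundle_size.

Section independence.
Context d (Omega : measurableType d) (R : realType) (P : probability Omega R).

Definition mutually_independent (I : choiceType) (G : I -> set_system Omega) :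
    Prop :=
  forall (J : {fset I}) (E : I -> set Omega),
    (forall i, i \in J -> G i (E i)) ->
    P (\bigcap_(i in [set` J]) E i) = (\prod_(i <- J) P (E i))%E.

Definition sigma_of d' (T' : measurableType d') (X : Omega -> T') :
    set_system Omega :=
  preimage_set_system setT X measurable.

Definition sigma_of_seq d' (T' : measurableType d') (X : nat -> Omega -> T') :
    set_system Omega :=
  <<s \bigcup_j sigma_of (X j) >>.

End independence.

Section poisson_process.
Context d (Omega : measurableType d) (R : realType) (P : probability Omega R).

(* Number of points of the process in ]s, t]; the index set is finite as soon
   as the points tend to infinity. *)
Definition npoints (T : nat -> Omega -> R) (s t : R) (w : Omega) : nat :=
  #|` fset_set [set j | s < T j w <= t] |.

(* The regularity of the paths is required at every w, not only almost surely.
   The process is given by the increasing enumeration T 0 < T 1 < ... of its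
   points. *)
Record is_poisson_process (lambda : R) (T : nat -> {RV P >-> R}) : Prop := {
  poisson_points_gt0 : forall j w, 0 < T j w ;
  poisson_points_incr : forall j w, T j w < T j.+1 w ;
  poisson_points_infty : forall w, T j w @[j --> \oo] --> +oo ;
  poisson_increment : forall s t k, 0 <= s < t ->
    P [set w | npoints T s t w = k] =
      (poisson_pmf (lambda * (t - s)) k)%:E ;
  poisson_independent_increments : forall u : nat -> R,
    0 <= u 0%N -> (forall l, u l <= u l.+1) ->
    mutually_independent P
      (fun l : nat => sigma_of (npoints T (u l) (u l.+1))) }.

(* T i j is the time of the j-th point of the process at location i, and B i j
   is its mark.  The last field says at once that the n processes and all the
   marks are mutually independent. *)
Record request_model (n : nat) (lambda : R) (f : nat -> R)
    (T : 'I_n -> nat -> {RV P >-> R}) (B : 'I_n -> nat -> {RV P >-> nat}) :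
    Prop := {
  model_times : forall i, is_poisson_process lambda (T i) ;
  model_marks : forall i j k, P [set w | B i j w = k] = (f k)%:E ;
  model_independent : mutually_independent P
    (fun x : 'I_n + 'I_n * nat =>
       match x with
       | inl i => sigma_of_seq (T i)
       | inr (i, j) => sigma_of (B i j)
       end) }.

End poisson_process.

(* Locations are numbered from 0: the i-th package is the ordinal i - 1. *)
Section packing.
Context (n : nat).

Definition line_fits (i : 'I_n) (k : nat) : bool := (i + k <= n)%N.

Definition line_zone (i : 'I_n) (k : nat) : {set 'I_n} :=
  [set l : 'I_n | (i <= l < i + k)%N]%SET.

Definition circle_fits (i : 'I_n) (k : nat) : bool := (k <= n)%N.

Definition circle_zone (i : 'I_n) (k : nat) : {set 'I_n} :=
  [set l : 'I_n | [exists j : 'I_k, (l : nat) == ((i + j) %% n)%N]]%SET.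

(* A is the set of packages already picked up. *)
Definition serve (fits : 'I_n -> nat -> bool) (zone : 'I_n -> nat -> {set 'I_n})
    (A : {set 'I_n}) (q : 'I_n * nat) : {set 'I_n} :=
  if fits q.1 q.2 && [disjoint zone q.1 q.2 & A] then A :|: zone q.1 q.2
  else A.

Context d (Omega : measurableType d) (R : realType) (P : probability Omega R).
Variables (T : 'I_n -> nat -> Omega -> R) (B : 'I_n -> nat -> Omega -> nat).

(* The points (i, j) in [0, t], in chronological order; a tie between two
   locations has probability 0. *)
Definition points_upto (t : R) (w : Omega) : seq ('I_n * nat) :=
  sort (fun p q => T p.1 p.2 w <= T q.1 q.2 w)
    (fset_set [set p : 'I_n * nat | T p.1 p.2 w <= t]).

Definition picked fits zone (t : R) (w : Omega) : {set 'I_n} :=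
  foldl (serve fits zone) finset.set0
    [seq (p.1, B p.1 p.2 w) | p <- points_upto t w].

Definition expected_picked fits zone (t : R) : \bar R :=
  ('E_P[fun w => #|picked fits zone t w|%:R])%E.

Definition line_K (t : R) : \bar R := expected_picked line_fits line_zone t.

Definition line_R (t : R) : \bar R := (n%:R%:E - line_K t)%E.

Definition circle_C (t : R) : \bar R :=
  expected_picked circle_fits circle_zone t.

End packing.

Section coefficients.
Context {R : realType}.

(* The boundary rows F n = 0 form an initial segment when F is a distribution
   function; on them the two recursive equations are not imposed. *)
Record is_gamma (F : nat -> R) (gamma : nat -> nat -> R) : Prop := {
  gamma_boundary : forall n i, (1 <= i <= n)%N -> F n = 0 -> gamma n i = 1 ;
  gamma_diag : forall n, (1 <= n)%N -> F n <> 0 ->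
    gamma n n = n%:R - \sum_(1 <= i < n) gamma n i ;
  gamma_rec : forall n i, (1 <= i < n)%N -> F n <> 0 ->
    gamma n i = 2 * ((\sum_(1 <= j < (n - i).+1) F j * gamma (n - j)%N i) /
                     (\sum_(i.+1 <= k < n.+1) F k)) }.

Lemma is_gamma_exists (F : nat -> R) : exists gamma, is_gamma F gamma.
Proof.
pose off (g : nat -> nat -> R) n i : R :=
  2 * ((\sum_(1 <= j < (n - i).+1) F j * g (n - j)%N i) /
       (\sum_(i.+1 <= k < n.+1) F k)).
pose row (g : nat -> nat -> R) n i : R :=
  if F n == 0 then 1
  else if i == n then n%:R - \sum_(1 <= l < n) off g n l else off g n i.
pose tab := fix tab N : nat -> nat -> R :=
  if N is N'.+1 then
    fun n i => if n == N then row (tab N') n i else tab N' n i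
  else fun _ _ => 0.
have tabE N n i : (n <= N)%N -> tab N n i = tab n n i.
  elim: N => [|N IH]; first by rewrite leqn0 => /eqP ->.
  rewrite leq_eqVlt => /orP[/eqP -> //|nN].
  by rewrite /= ltn_eqF//; exact: IH.
have offE n i : off (tab n) n.+1 i = off (fun a => tab a a) n.+1 i.
  congr (2 * (_ / _)); apply: eq_big_nat => j /andP[j1 _].
  by rewrite tabE// leq_subLR; case: j j1 => // j _; rewrite addSn ltnS leq_addl.
exists (fun n => tab n n); split.
- by move=> [|n] i; [case: i|move=> _ F0; rewrite /= eqxx /row F0 eqxx].
- move=> [|n]// _ /eqP/negPf F0; rewrite [LHS]/= /row !eqxx F0; congr (_ - _).
  apply: eq_big_nat => l /andP[_ ln].
  by rewrite [RHS]/= /row eqxx F0 (ltn_eqF ln).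
- move=> [|n] i /andP[i1 ilt]// /eqP/negPf F0.
  by rewrite [LHS]/= /row eqxx F0 (ltn_eqF ilt) offE.
Qed.

Definition gamma_circle_off (f : nat -> R) (gamma : nat -> nat -> R)
    (n i : nat) : R :=
  \sum_(1 <= k < (n - i).+1)
    f k * (gamma (n - k)%N i /
           (1 - n%:R^-1 * \sum_(1 <= j < i.+1) size_cdf f j)).

Definition gamma_circle (f : nat -> R) (gamma : nat -> nat -> R)
    (n i : nat) : R :=
  if i == n then n%:R - \sum_(1 <= l < n) gamma_circle_off f gamma n l
  else gamma_circle_off f gamma n i.

End coefficients.

(* Main.v *)
Require Import Defs.
From HB Require Import structures.
From mathcomp Require Import all_boot all_order all_algebra finmap.
From mathcomp Require Import all_classical all_reals all_analysis.
From mathcomp Require Import measurable_realfun.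
From mathcomp Require Import zify ring lra.

(** Both models are continuous-time Markov chains on the sets [A] of packages
    already picked up: at rate [lambda * n] a uniform location [i] and an
    independent size [k] of law [f] turn [A] into [serve fits zone A (i, k)].
    The proof diagonalises this chain just enough to compute one expectation.

    Eigenfunctions.  On the line, the future of a state only depends on the
    lengths of its maximal free runs, and splitting a run of length [L] turns it
    into two runs.  So a sum over the runs, of a function [g] of their lengths,
    is mapped by the generator to a sum over the runs of
    [2 * \sum_(l < L) F (L - l) * g l - (\sum_(1 <= l < L.+1) F l) * g L]
    ([list_genE], [run_genE]).  The recursion defining [gamma] says exactly that
    [g L = gamma L j], extended by [0] to [L < j], is an eigenvector for
    [- \sum_(1 <= l < j.+1) F l] ([run_gen_gamma]), and the equation for
    [gamma n n] says that these eigenvectors add up to the length [L].  Hence the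
    number of free packages is a sum of eigenfunctions, the [j]-th one having
    value [gamma n j] at the empty state ([line_val_sum], [line_val_eigen]).
    On the circle, a nonempty state is cut at any of its occupied sites and becomes
    a line of [n - 1] sites; the value at the empty state is then forced by the
    eigenvalue equation and gives the circle coefficients
    ([circle_val_sum], [circle_val_eigen]).

    From eigenfunctions to the expectation.  Cut [0, t] into [N] cells of length
    [h = t / N].  A history says that every cell contains no point, or exactly one
    point, at a given location and with a given mark.  Different histories are
    disjoint events; by independence the probability of a history is the product
    of the weights of its cells ([history_event_prob]), and on it the final state
    is obtained by serving the requests in the order of the cells
    ([picked_history]).  The sum over all histories of probability times an
    eigenfunction of eigenvalue [- s] is therefore exactly
    [(expR (- n lambda h) * (1 + lambda h (n - s))) ^+ N] times its initial value
    ([sum_histories]), which tends to [expR (- lambda s t)].  For [s = 0] and the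
    constant function this says that the histories exhaust the probability space
    in the limit, so that the expectation is squeezed between two sequences with
    the same limit ([expected_picked_eigen]).  The integral of a nonnegative function
    being a supremum over simple functions, the squeeze applies directly to the
    number of picked packages ([integral_sandwich]). *)

Set Implicit Arguments.
Unset Strict Implicit.
Unset Printing Implicit Defensive.

Import Order.TTheory GRing.Theory Num.Theory.
Import numFieldNormedType.Exports.

Local Open Scope classical_set_scope.
Local Open Scope ring_scope.

(** * Sums over the free runs of a configuration *)

Section runs.
Context {R : realType}.
Implicit Types (g f : nat -> R) (b : seq bool).

(** The sum of [g] over the lengths of the maximal runs of [true], the first run
    being lengthened by [a].  Every [false] closes a possibly empty run, which is
    harmless when [g 0 = 0]. *)
Fixpoint run_sum g (a : nat) b : R :=
  match b with
  | [::] => g a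
  | true :: b' => run_sum g a.+1 b'
  | false :: b' => g a + run_sum g 0 b'
  end.

(** An occupied site separates what happens on its two sides; everything about
    runs is reduced to this additivity and to the case of a single run. *)
Lemma run_sum_cat g a b1 b2 :
  run_sum g a (b1 ++ false :: b2) = run_sum g a b1 + run_sum g 0 b2.
Proof. by elim: b1 a => [|[] b1 IH] a //=; rewrite IH ?addrA. Qed.

Lemma run_sum_nseq_true g a k b :
  run_sum g a (nseq k true ++ b) = run_sum g (a + k) b.
Proof. by elim: k a => [|k IH] a /=; rewrite ?addn0// IH addSnnS. Qed.

Lemma run_sum_nseq_false g k b :
  g 0%N = 0 -> run_sum g 0 (nseq k false ++ b) = run_sum g 0 b.
Proof. by move=> g0; elim: k => //= k IH; rewrite g0 add0r. Qed.

Lemma eq_run_sum g g' a b :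
  (forall L, (L <= a + size b)%N -> g L = g' L) ->
  run_sum g a b = run_sum g' a b.
Proof.
elim: b a => [|[] b IH] a E /=; first by apply: E; rewrite addn0.
  by apply: IH => L h; apply: E; rewrite /= -addSnnS.
rewrite E ?leq_addr// IH// => L h; apply: E => /=.
by rewrite (leq_trans h)// add0n addnS ltnW// ltnS leq_addl.
Qed.

Lemma run_sum_sum (I : Type) (r : seq I) (G : I -> nat -> R) a b :
  run_sum (fun L => \sum_(i <- r) G i L) a b = \sum_(i <- r) run_sum (G i) a b.
Proof. by elim: b a => [|[] b IH] a //=; rewrite IH big_split. Qed.

Lemma run_sum_scale (c : R) g a b :
  run_sum (fun L => c * g L) a b = c * run_sum g a b.
Proof. by elim: b a => [|[] b IH] a //=; rewrite IH mulrDr. Qed.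

Lemma run_sum_id a b :
  run_sum (fun L => L%:R) a b = (a + count id b)%:R.
Proof.
elim: b a => [|[] b IH] a /=; rewrite ?addn0// IH ?addSnnS//.
by rewrite !add0n -natrD.
Qed.

(** Since [nth] has default value [false], a nonempty zone that leaves the list is
    not available. *)
Definition avail b (i k : nat) : bool := all (nth false b) (iota i k).

Definition carve b (i k : nat) : seq bool :=
  mkseq (fun y => nth false b y && ~~ (i <= y < i + k)%N) (size b).

Lemma availP b i k :
  reflect (forall y, (i <= y < i + k)%N -> nth false b y) (avail b i k).
Proof.
by apply: (iffP allP) => h y; have := h y; rewrite mem_iota.
Qed.

Lemma nth_carve b i k y :
  nth false (carve b i k) y = nth false b y && ~~ (i <= y < i + k)%N.
Proof.
have [yb|by_] := ltnP y (size b); first by rewrite nth_mkseq.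
by rewrite !nth_default// size_mkseq.
Qed.

Lemma size_carve b i k : size (carve b i k) = size b.
Proof. by rewrite size_mkseq. Qed.

Lemma avail_catl b1 b2 i k : (0 < k)%N -> (i <= size b1)%N ->
  avail (b1 ++ false :: b2) i k = (i + k <= size b1)%N && avail b1 i k.
Proof.
move=> k0 ib; apply/availP/andP => [h|[ik /availP h] y yik].
  have ik : (i + k <= size b1)%N.
    rewrite leqNgt; apply/negP => c; have := h (size b1).
    by rewrite nth_cat ltnn subnn/= ib c => /(_ isT).
  split=> //; apply/availP => y yik; have := h y yik.
  by rewrite nth_cat (leq_trans _ ik)//; case/andP: yik.
by rewrite nth_cat (leq_trans _ ik) ?h//; case/andP: yik.
Qed.

Lemma nth_cat_false b1 b2 y :
  nth false (b1 ++ false :: b2) ((size b1).+1 + y) = nth false b2 y.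
Proof.
have -> : ((size b1).+1 + y = size b1 + y.+1)%N by rewrite addnS.
by rewrite nth_cat ltnNge leq_addr/= addKn.
Qed.

Lemma avail_catr b1 b2 j k :
  avail (b1 ++ false :: b2) ((size b1).+1 + j) k = avail b2 j k.
Proof.
apply/availP/availP => h y yik.
  by rewrite -(nth_cat_false b1); apply: h; lia.
rewrite (_ : y = (size b1).+1 + (y - (size b1).+1))%N; last by lia.
by rewrite nth_cat_false; apply: h; lia.
Qed.

Lemma carve_catl b1 b2 i k : (i + k <= size b1)%N ->
  carve (b1 ++ false :: b2) i k = carve b1 i k ++ false :: b2.
Proof.
move=> ik; apply: (@eq_from_nth _ false).
  by rewrite size_carve !size_cat/= size_carve.
move=> y _; rewrite nth_carve !nth_cat size_carve.
case: ltnP => yb; first by rewrite nth_carve.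
by rewrite (_ : (i <= y < i + k)%N = false) ?andbT//; lia.
Qed.

Lemma carve_catr b1 b2 j k :
  carve (b1 ++ false :: b2) ((size b1).+1 + j) k = b1 ++ false :: carve b2 j k.
Proof.
apply: (@eq_from_nth _ false).
  by rewrite size_carve !size_cat/= size_carve.
move=> y _; rewrite nth_carve !nth_cat.
case: ltnP => yb.
  by rewrite (_ : (_ <= y < _)%N = false) ?andbT//; lia.
case E: (y - size b1)%N => [|z] //=.
by rewrite nth_carve; congr (_ && ~~ _); lia.
Qed.

(** The generator of the chain on a line of sites, without the factor [lambda],
    applied to the function [run_sum g 0] at the configuration [b]. *)
Definition list_gen K f g b : R :=
  \sum_(i < size b) \sum_(k < K)
    f k * (if avail b i k then run_sum g 0 (carve b i k) - run_sum g 0 b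
           else 0).

(** The effect of the generator on one run of length [L]: a request of size [k] at
    position [i] of the run leaves runs of lengths [i] and [L - i - k]. *)
Definition run_gen K f g (L : nat) : R :=
  \sum_(i < L) \sum_(k < K | (i + k <= L)%N)
    f k * (g i + g (L - i - k)%N - g L).

Lemma list_gen_cat K f g b1 b2 : f 0%N = 0 ->
  list_gen K f g (b1 ++ false :: b2) = list_gen K f g b1 + list_gen K f g b2.
Proof.
move=> f0; rewrite {1}/list_gen size_cat big_split_ord/=.
rewrite big_ord_recl/= [X in _ + (X + _)]big1 ?add0r; last first.
  move=> k _; have [->|k0] := posnP k; first by rewrite f0 mul0r.
  rewrite addn0 avail_catl// (_ : (size b1 + k <= size b1)%N = false) ?mulr0//.
  by lia.
congr (_ + _); apply: eq_bigr => i _; apply: eq_bigr => k _.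
  have [->|k0] := posnP k; first by rewrite f0 !mul0r.
  have ib := ltnW (ltn_ord i); rewrite avail_catl//.
  case: leqP => ik /=; last first.
    case: ifPn => // /availP h; have := h (size b1).
    by rewrite nth_default// ib ik => /(_ isT).
  by rewrite carve_catl// !run_sum_cat opprD addrACA subrr addr0.
rewrite /bump/= add1n addnS -addSn avail_catr carve_catr.
by rewrite !run_sum_cat opprD addrACA subrr add0r.
Qed.

Lemma list_gen_true K f g L : f 0%N = 0 -> g 0%N = 0 ->
  list_gen K f g (nseq L true) = run_gen K f g L.
Proof.
move=> f0 g0; rewrite /list_gen size_nseq; apply: eq_bigr => i _.
rewrite [RHS]big_mkcond/=; apply: eq_bigr => k _.
have [->|k0] := posnP k; first by rewrite f0 !mul0r; case: ifP.
have -> : avail (nseq L true) i k = (i + k <= L)%N.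
  apply/availP/idP => [h|h y yik].
    rewrite leqNgt; apply/negP => c.
    by have := h L; rewrite nth_nseq ltnn (ltnW (ltn_ord i)) c => /(_ isT).
  by rewrite nth_nseq ifT//; lia.
case: leqP => ik; last by rewrite mulr0.
have -> : carve (nseq L true) i k =
    nseq i true ++ false :: (nseq k.-1 false ++ nseq (L - i - k) true).
  apply: (@eq_from_nth _ false).
    by rewrite size_carve !(size_cat, size_nseq)/= size_cat !size_nseq; lia.
  move=> y; rewrite size_carve size_nseq => yL.
  rewrite nth_carve !nth_cat !nth_nseq size_nseq yL/=.
  have [yi|yi] := ltnP y i; first by [].
  rewrite /=.
  case E: (y - i)%N => [|z] /=; first by apply/negbTE; rewrite negbK; lia.
  rewrite nth_cat !nth_nseq size_nseq; have [zk|zk] := ltnP z k.-1; last first.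
    by rewrite ifT; lia.
  by apply/negbTE; rewrite negbK; lia.
rewrite run_sum_cat -[nseq i true]cats0 run_sum_nseq_true run_sum_nseq_false//.
rewrite -[nseq (L - i - k) true]cats0 -[nseq L true]cats0 !run_sum_nseq_true/=.
by rewrite !add0n.
Qed.

(** The free runs evolve independently: by [list_gen_cat] the generator is additive
    over the runs, and [list_gen_true] computes it on a single one. *)
Lemma list_genE K f g b : f 0%N = 0 -> g 0%N = 0 ->
  list_gen K f g b = run_sum (run_gen K f g) 0 b.
Proof.
move=> f0 g0; have [l] := ubnP (size b); elim: l b => // l IH b bl.
have [/all_pred1P E|] := boolP (all (pred1 true) b).
  rewrite E list_gen_true// -[in RHS](cats0 (nseq _ _)) run_sum_nseq_true/=.
  by rewrite add0n.
rewrite -has_predC => hb; move: bl; case/split_find: hb => x b1 b2 /= xF _.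
have -> : x = false by case: x xF.
rewrite cat_rcons => bl.
rewrite list_gen_cat// run_sum_cat !IH//; move: bl; rewrite size_cat/=; lia.
Qed.

(** The left and right remainders of the run have the same law by reflection,
    whence the factor [2]. *)
Lemma run_genE K f g L : f 0%N = 0 ->
  let F a := \sum_(k < K | (k <= a)%N) f k in
  run_gen K f g L =
    2 * (\sum_(j < L) F (L - j)%N * g j) - (\sum_(1 <= j < L.+1) F j) * g L.
Proof.
move=> f0 F; rewrite /run_gen.
have FE (i : 'I_L) c :
    \sum_(k < K | (i + k <= L)%N) f k * c = F (L - i)%N * c.
  rewrite -mulr_suml; congr (_ * _); apply: eq_bigl => k.
  by rewrite leq_subRL// ltnW.
under eq_bigr => i _.
  under eq_bigr do rewrite mulrBr mulrDr.
  rewrite sumrB big_split/= !FE.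
  over.
rewrite sumrB big_split/= -mulr_suml; congr (_ - _ * _); last first.
  rewrite big_add1/= big_mkord (reindex_inj rev_ord_inj)/=.
  by apply: eq_bigr => i _; congr F; have := ltn_ord i; lia.
rewrite mulr_natl mulr2n; congr (_ + _).
(* The position i = L can be added: it only allows k = 0, and f 0 = 0. *)
transitivity (\sum_(i < L.+1) \sum_(k < K | (i + k <= L)%N)
    f k * g (L - i - k)%N).
  rewrite [RHS]big_ord_recr/= [X in _ + X]big1 ?addr0// => k Lk.
  by rewrite (_ : k = 0%N :> nat) ?f0 ?mul0r//; lia.
transitivity (\sum_(i < L.+1) \sum_(k < K | (i + k <= L)%N) f k * g i);
    last first.
  rewrite big_ord_recr/= [X in _ + X]big1 ?addr0//; last first.
    by move=> k Lk; rewrite (_ : k = 0%N :> nat) ?f0 ?mul0r//; lia.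
  by apply: eq_bigr => i _; rewrite FE.
rewrite (exchange_big_dep xpredT)//= [RHS](exchange_big_dep xpredT)//=.
apply: eq_bigr => k _; rewrite -!mulr_sumr; congr (_ * _).
have [kL|Lk] := leqP k L; last first.
  by rewrite !big_pred0// => i; lia.
have le : ((L - k).+1 <= L.+1)%N by lia.
transitivity (\sum_(i < (L - k).+1) g (L - i - k)%N).
  rewrite (big_ord_widen _ (fun i => g (L - i - k)%N) le).
  by apply: eq_bigl => i; lia.
transitivity (\sum_(i < (L - k).+1) g i); last first.
  by rewrite (big_ord_widen _ g le); apply: eq_bigl => i; lia.
rewrite (reindex_inj rev_ord_inj)/=; apply: eq_bigr => i _.
by congr g; have := ltn_ord i; lia.
Qed.

End runs.

(** * The coefficients as eigenvectors on run lengths *)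

Section gamma_runs.
Context {R : realType} (m : nat) (f : nat -> R) (gamma : nat -> nat -> R).
Hypotheses (hf : is_size_pmf m f) (hgamma : is_gamma (size_cdf f) gamma).

Definition run_gamma (j L : nat) : R := if (1 <= j <= L)%N then gamma L j else 0.

(** The total rate of the requests that fit in an empty line of [j] packages,
    in units of [lambda]. *)
Definition exponent (j : nat) : R := \sum_(1 <= a < j.+1) size_cdf f a.

Lemma pmf0 : f 0%N = 0.
Proof. by case: hf => _ + _; apply. Qed.

Lemma pmf_sum1 : \sum_(k < m.+1) f k = 1.
Proof.
by case: hf => _ _ <-; rewrite big_ord_recl pmf0 add0r big_add1/= big_mkord.
Qed.

Lemma size_cdfE a : \sum_(k < m.+1 | (k <= a)%N) f k = size_cdf f a.
Proof.
have f_out k : (m < k)%N -> f k = 0.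
  by move=> mk; case: hf => _ + _; apply; lia.
rewrite /size_cdf; have [am|ma] := leqP a m.
  by rewrite (big_ord_widen _ f (_ : (a.+1 <= m.+1)%N)).
rewrite [in LHS](eq_bigl xpredT)/=; last by move=> k; have := ltn_ord k; lia.
rewrite (big_ord_widen _ f (_ : (m.+1 <= a.+1)%N)); last by rewrite ltnS ltnW.
rewrite [LHS]big_mkcond/=; apply: eq_bigr => k _.
by case: ltnP => // mk; rewrite f_out.
Qed.

Lemma size_cdf_ge0 a : 0 <= size_cdf f a.
Proof. by apply: sumr_ge0 => k _; case: hf. Qed.

Lemma size_cdf_le1 a : size_cdf f a <= 1.
Proof.
rewrite -size_cdfE -pmf_sum1 [leLHS]big_mkcond/=.
by apply: ler_sum => k _; case: ifP => // _; case: hf.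
Qed.

Lemma size_cdf_le a b : (a <= b)%N -> size_cdf f a <= size_cdf f b.
Proof.
move=> ab; rewrite -!size_cdfE [leLHS]big_mkcond [leRHS]big_mkcond/=.
apply: ler_sum => k _; case: ifP => [ka|_]; first by rewrite (leq_trans ka ab).
by case: ifP => // _; case: hf.
Qed.

Lemma exponent_ge0 j : 0 <= exponent j.
Proof. by apply: sumr_ge0 => a _; exact: size_cdf_ge0. Qed.

Lemma exponent_le j : exponent j <= j%:R.
Proof.
rewrite /exponent (_ : j%:R = \sum_(1 <= a < j.+1) 1).
  by apply: ler_sum => a _; exact: size_cdf_le1.
by rewrite sumr_const_nat subn1.
Qed.

Lemma run_gamma0 j : run_gamma j 0 = 0.
Proof. by rewrite /run_gamma; case: j. Qed.

(** This is the recursion for [gamma], multiplied by its denominator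
    [exponent L - exponent j].  On the boundary rows [size_cdf f L = 0] all the rates
    up to [L] vanish, so that both sides are [0]. *)
Lemma run_gen_gamma j L : (1 <= j)%N ->
  run_gen m.+1 f (run_gamma j) L = - exponent j * run_gamma j L.
Proof.
move=> j1; rewrite run_genE ?pmf0//.
rewrite (eq_bigr (fun i : 'I_L => size_cdf f (L - i) * run_gamma j i));
  last by move=> i _; rewrite size_cdfE.
under [X in _ - X * _]eq_bigr do rewrite size_cdfE.
rewrite -/(exponent L).
have [Lj|jL|->] := ltngtP L j.
- rewrite {2 3}/run_gamma (leqNgt j) Lj andbF !mulr0 subr0 big1 ?mulr0// => i _.
  by rewrite /run_gamma (leqNgt j) (ltn_trans (ltn_ord i) Lj) andbF mulr0.
- have [F0|/eqP F0] := eqVneq (size_cdf f L) 0.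
    have Fz a : (a <= L)%N -> size_cdf f a = 0.
      move=> aL; apply/eqP; rewrite eq_le size_cdf_ge0 andbT -F0.
      exact: size_cdf_le.
    have Ez a : (a <= L)%N -> exponent a = 0.
      move=> aL; rewrite /exponent big_nat big1// => b /andP[_ ba].
      by rewrite Fz//; lia.
    rewrite (Ez L)// (Ez j (ltnW jL)) oppr0 !mul0r subr0 big1 ?mulr0// => i _.
    by rewrite Fz ?mul0r// leq_subr.
  have EL : exponent L = exponent j + \sum_(j.+1 <= k < L.+1) size_cdf f k.
    by rewrite /exponent -big_cat_nat//= ltnS ltnW.
  have rec := @gamma_rec _ _ _ hgamma L j _ F0.
  have D0 : \sum_(j.+1 <= k < L.+1) size_cdf f k != 0.
    rewrite big_nat_recr//=; apply: lt0r_neq0; apply: ltr_wpDl.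
      by apply: sumr_ge0 => k _; exact: size_cdf_ge0.
    by rewrite lt_neqAle size_cdf_ge0 andbT eq_sym; apply/eqP.
  have SE : \sum_(i < L) size_cdf f (L - i) * run_gamma j i =
      \sum_(1 <= a < (L - j).+1) size_cdf f a * gamma (L - a)%N j.
    rewrite (reindex_inj rev_ord_inj)/=.
    rewrite (eq_bigr (fun i : 'I_L =>
      size_cdf f i.+1 * run_gamma j (L - i.+1))); last first.
      by move=> i _; rewrite subKn.
    rewrite big_add1/= big_mkord.
    rewrite (big_ord_widen _ (fun a => size_cdf f a.+1 * gamma (L - a.+1)%N j)
      (leq_subr j L)) [RHS]big_mkcond/=.
    apply: eq_bigr => i _; rewrite /run_gamma j1/=.
    have -> : (j <= L - i.+1)%N = (i < L - j)%N by have := ltn_ord i; lia.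
    by case: ifP; rewrite ?mulr0.
  rewrite SE /run_gamma j1 ltnW//= EL rec ?j1//.
  by field.
- rewrite big1 ?mulr0 ?sub0r ?mulNr// => i _.
  by rewrite /run_gamma (leqNgt j) ltn_ord andbF mulr0.
Qed.

(** The initial condition: at time [0] all packages of a run are present. *)
Lemma sum_run_gamma n L : (L <= n)%N ->
  \sum_(1 <= j < n.+1) run_gamma j L = L%:R.
Proof.
move=> Ln; rewrite (big_cat_nat (n := L.+1))//=.
rewrite [X in _ + X]big_nat [X in _ + X]big1 ?addr0; last first.
  by move=> j /andP[Lj _]; rewrite /run_gamma (leqNgt j) Lj andbF.
case: L Ln => [|L] Ln; first by rewrite big_geq.
have [F0|/eqP F0] := eqVneq (size_cdf f L.+1) 0.
  rewrite big_nat (eq_bigr (fun=> 1)).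
    by rewrite -big_nat sumr_const_nat subn1.
  by move=> j jL; rewrite /run_gamma -ltnS jL (gamma_boundary hgamma).
rewrite big_nat_recr//= {2}/run_gamma leqnn/= (gamma_diag hgamma)//.
rewrite big_nat (eq_bigr (fun j => gamma L.+1 j)); last first.
  by move=> j /andP[j1 jL]; rewrite /run_gamma j1 ltnW.
by rewrite -big_nat addrC subrK.
Qed.

End gamma_runs.

(** * Eigenfunctions of the line and of the circle *)

Section free_lists.
Context {R : realType} (n : nat).
Implicit Types (A : {set 'I_n.+1}) (fits : 'I_n.+1 -> nat -> bool).
Implicit Types (zone : 'I_n.+1 -> nat -> {set 'I_n.+1}) (phi : nat -> 'I_n.+1).

(** The configuration seen along [phi 0, phi 1, ...]; [phi] is the natural
    enumeration for the line, and the enumeration that follows an occupied site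
    for the circle. *)
Definition free_list phi (M : nat) A : seq bool :=
  mkseq (fun y => phi y \notin A) M.

(** Serving a request on sets amounts to carving its zone out of the list, as soon
    as [phi] identifies the zones with the intervals of the list. *)
Lemma run_sum_serve (g : nat -> R) fits zone phi M A y k :
  (fits (phi y) k && [disjoint zone (phi y) k & A]) =
    avail (free_list phi M A) y k ->
  (avail (free_list phi M A) y k -> forall z, (z < M)%N ->
     (phi z \in zone (phi y) k) = (y <= z < y + k)%N) ->
  run_sum g 0 (free_list phi M (serve fits zone A (phi y, k)))
    - run_sum g 0 (free_list phi M A) =
  if avail (free_list phi M A) y k then
    run_sum g 0 (carve (free_list phi M A) y k)
    - run_sum g 0 (free_list phi M A)
  else 0.
Proof.
rewrite /serve => /= -> h; case: ifP => [av|]; last by rewrite subrr.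
congr (run_sum _ _ _ - _); apply: (@eq_from_nth _ false).
  by rewrite size_carve !size_mkseq.
move=> z; rewrite size_mkseq => zM.
by rewrite nth_carve !nth_mkseq// inE negb_or h// andbC.
Qed.

End free_lists.

(** The jump operator, [n] plus the generator in units of [lambda]: an
    eigenvalue [- s] of the generator is an eigenvalue [n - s] of [jump_sum]. *)
Definition jump_sum (R : realType) (m : nat) (f : nat -> R) n fits zone
    (v : {set 'I_n} -> R) (A : {set 'I_n}) : R :=
  \sum_(i : 'I_n) \sum_(k < m.+1)
    f k * v (serve fits zone A (i, nat_of_ord k)).

Section eigenfunctions.
Context {R : realType} (m : nat) (f : nat -> R) (gamma : nat -> nat -> R).
Hypotheses (hf : is_size_pmf m f) (hgamma : is_gamma (size_cdf f) gamma).
Variable n : nat.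
Implicit Types (A : {set 'I_n.+1}) (x i : 'I_n.+1).

Lemma jump_sumE fits zone (v : {set 'I_n.+1} -> R) A :
  jump_sum m f fits zone v A = n.+1%:R * v A +
    \sum_(i : 'I_n.+1) \sum_(k < m.+1)
      f k * (v (serve fits zone A (i, nat_of_ord k)) - v A).
Proof.
rewrite (_ : n.+1%:R * v A = \sum_(i : 'I_n.+1) \sum_(k < m.+1) f k * v A).
  rewrite -big_split/=; apply: eq_bigr => i _; rewrite -big_split/=.
  by apply: eq_bigr => k _; rewrite -mulrDr addrC subrK.
under eq_bigr do rewrite -mulr_suml (pmf_sum1 hf) mul1r.
by rewrite sumr_const card_ord mulr_natl.
Qed.

Lemma sum_run_gamma_free phi M A : (M <= n.+1)%N ->
  \sum_(1 <= j < n.+2) run_sum (run_gamma gamma j) 0 (free_list phi M A) =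
  (\sum_(y < M) (phi y \notin A))%:R.
Proof.
move=> Mn; rewrite -run_sum_sum.
rewrite (@eq_run_sum _ _ (fun L => L%:R)); last first.
  move=> L; rewrite size_mkseq add0n => LM.
  exact: (sum_run_gamma hgamma (leq_trans LM Mn)).
rewrite run_sum_id add0n -sumn_count /free_list /mkseq -map_comp.
rewrite sumnE big_map.
by rewrite -(big_mkord xpredT (fun y => nat_of_bool (phi y \notin A))) /index_iota subn0.
Qed.

Lemma card_free phi A :
  injective (fun y : 'I_n.+1 => phi (nat_of_ord y) : 'I_n.+1) ->
  (\sum_(y < n.+1) (phi y \notin A))%:R = n.+1%:R - #|A|%:R :> R.
Proof.
move=> phiI; have -> : n.+1%:R - #|A|%:R = #|~: A|%:R :> R.
  by apply/eqP; rewrite subr_eq addrC -natrD cardsC card_ord.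
rewrite -sum1_card [in RHS]big_mkcond/= [in RHS](reindex_inj phiI)/=.
by congr _%:R; apply: eq_bigr => y _; rewrite inE.
Qed.

Definition line_val j A : R :=
  run_sum (run_gamma gamma j) 0 (free_list inord n.+1 A).

Lemma line_val0 j : (1 <= j <= n.+1)%N -> line_val j finset.set0 = gamma n.+1 j.
Proof.
move=> jn; rewrite /line_val.
rewrite (_ : free_list _ _ _ = nseq n.+1 true); last first.
  apply: (@eq_from_nth _ false); first by rewrite size_mkseq size_nseq.
  by move=> y; rewrite size_mkseq => yn; rewrite nth_mkseq// nth_nseq yn inE.
rewrite -[nseq _ _]cats0 run_sum_nseq_true /= add0n /run_gamma ifT//.
Qed.

Lemma line_val_sum A :
  \sum_(1 <= j < n.+2) line_val j A = n.+1%:R - #|A|%:R.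
Proof.
rewrite sum_run_gamma_free// card_free// => y z.
by rewrite !inord_val.
Qed.

Lemma line_val_eigen j A : (1 <= j)%N ->
  jump_sum m f (@line_fits n.+1) (@line_zone n.+1) (line_val j) A =
  (n.+1%:R - exponent f j) * line_val j A.
Proof.
move=> j1; rewrite jump_sumE mulrBl -mulNr; congr (_ + _).
rewrite /line_val -run_sum_scale.
rewrite -(@eq_run_sum _ _ _ _ _ (fun L _ => run_gen_gamma hf hgamma L j1)).
rewrite -list_genE ?(pmf0 hf) ?run_gamma0//.
rewrite /list_gen size_mkseq; apply: eq_bigr => i _; apply: eq_bigr => k _.
have [->|k0] := posnP k; first by rewrite (pmf0 hf) !mul0r.
congr (_ * _); rewrite -(@run_sum_serve _ _ _ (@line_fits n.+1) (@line_zone n.+1));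
  rewrite ?inord_val//.
- rewrite /line_fits; apply/andP/availP => [[ik /pred0P dA] y yik|h].
    rewrite nth_mkseq; last by lia.
    have := dA (inord y); rewrite /= inE inordK; last by lia.
    by rewrite yik/= => ->.
  have ik : (i + k <= n.+1)%N.
    rewrite leqNgt; apply/negP => c; have := h n.+1.
    by rewrite nth_default ?size_mkseq// (ltnW (ltn_ord i)) c => /(_ isT).
  split=> //; apply/pred0P => l /=; rewrite inE; apply/negP => /andP[lik lA].
  by have := h l lik; rewrite nth_mkseq// inord_val lA.
- by move=> _ z zn; rewrite inE inordK.
Qed.

(** The sites of the circle in cyclic order from the successor of [x]; [x] itself
    comes last, at index [n]. *)
Definition cut x (y : nat) : 'I_n.+1 := inord ((x + 1 + y) %% n.+1).

Lemma val_cut x y : cut x y = ((x + 1 + y) %% n.+1)%N :> nat.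
Proof. by rewrite inordK// ltn_pmod. Qed.

Lemma cut_inj x y z : (y < n.+1)%N -> (z < n.+1)%N -> cut x y = cut x z -> y = z.
Proof.
move=> yn zn /(congr1 (@nat_of_ord _)); rewrite !val_cut => /eqP.
by rewrite eqn_modDl !modn_small// => /eqP.
Qed.

Lemma cut_last x : cut x n = x.
Proof.
by apply: val_inj; rewrite /= val_cut -addnA add1n modnDr modn_small.
Qed.

Lemma cut_cut x y z : cut (cut x y) z = cut x (y + 1 + z).
Proof.
by apply: val_inj; rewrite /= !val_cut -!addnA modnDml -!addnA.
Qed.

Lemma cut_periodic x y : cut x (n.+1 + y) = cut x y.
Proof. by apply: val_inj; rewrite /= !val_cut addnCA modnDl. Qed.

Lemma cut_surj x i : i != x -> exists2 q, (q < n)%N & i = cut x q.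
Proof.
move=> ix; pose q := ((i + n - x) %% n.+1)%N.
have qE : i = cut x q.
  apply: val_inj; rewrite /= val_cut modnDmr.
  rewrite (_ : x + 1 + (i + n - x) = i + n.+1)%N; last by have := ltn_ord x; lia.
  by rewrite modnDr modn_small.
exists q => //; rewrite ltn_neqAle -ltnS ltn_pmod// andbT.
by apply: contra ix => /eqP qn; rewrite qE qn cut_last.
Qed.

Lemma mkseq_split (T : Type) (h : nat -> T) q r :
  mkseq h (q + r.+1) = mkseq h q ++ h q :: mkseq (fun y => h (q.+1 + y)%N) r.
Proof.
rewrite /mkseq iotaD map_cat add0n /=; congr (_ ++ _ :: _).
by rewrite -(addn0 q.+1) iotaDl -map_comp addn0.
Qed.

(** Cutting at another occupied site rotates the list around an occupied site, that
    is, exchanges the two parts separated by that site. *)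
Lemma run_sum_cut (g : nat -> R) A x x' : x \in A -> x' \in A ->
  run_sum g 0 (free_list (cut x) n A) = run_sum g 0 (free_list (cut x') n A).
Proof.
move=> xA; have [-> //|/cut_surj[q qn ->] qA] := eqVneq x' x.
have [r nE] : exists r, n = (q + r.+1)%N by exists (n - q.+1)%N; lia.
have mE (h : nat -> bool) :
    mkseq h n = mkseq h q ++ h q :: mkseq (fun y => h (q.+1 + y)%N) r.
  by rewrite nE mkseq_split.
have mE' (h : nat -> bool) :
    mkseq h n = mkseq h r ++ h r :: mkseq (fun y => h (r.+1 + y)%N) q.
  by rewrite (_ : n = r + q.+1)%N ?mkseq_split//; lia.
rewrite /free_list mE mE' qA/= run_sum_cat cut_cut.
rewrite (_ : q + 1 + r = n)%N; last by lia.
rewrite cut_last xA/= run_sum_cat addrC; congr (run_sum _ _ _ + run_sum _ _ _).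
  by apply: eq_mkseq => y; rewrite cut_cut addn1.
apply: eq_mkseq => y; rewrite cut_cut (_ : _ + _ + _ = n.+1 + y)%N; last by lia.
by rewrite cut_periodic.
Qed.

Lemma circle_zoneE x y k l :
  (l \in circle_zone (cut x y) k) = [exists j : 'I_k, l == cut x (y + j)].
Proof.
rewrite inE; apply: eq_existsb => j.
by rewrite -val_eqE/= val_cut modnDml -addnA -val_cut.
Qed.

(** The [j]-th eigenfunction on the circle.  On nonempty states the choice of the
    cut is irrelevant by [run_sum_cut]; the last one, [j = n.+1], is supported by
    the empty state. *)
Definition circle_val j A : R :=
  if [pick x in A] is Some x then
    run_sum (run_gamma gamma j) 0 (free_list (cut x) n A)
  else gamma_circle f gamma n.+1 j.

(** An empty circle of [n.+1 >= m] packages accepts every request, whence the last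
    rate. *)
Definition circle_rate j : R := if j == n.+1 then n.+1%:R else exponent f j.

Lemma circle_valE x j A : x \in A ->
  circle_val j A = run_sum (run_gamma gamma j) 0 (free_list (cut x) n A).
Proof.
rewrite /circle_val; case: pickP => [x' x'A xA|/(_ x) -> //].
exact: run_sum_cut.
Qed.

Lemma circle_val0 j : circle_val j finset.set0 = gamma_circle f gamma n.+1 j.
Proof. by rewrite /circle_val; case: pickP => // x; rewrite inE. Qed.

Lemma circle_val_top x A : x \in A -> circle_val n.+1 A = 0.
Proof.
move=> xA; rewrite (circle_valE _ xA).
rewrite (@eq_run_sum _ _ (fun L => 0 * L%:R)) ?run_sum_scale ?mul0r// => L.
by rewrite size_mkseq add0n mul0r /run_gamma => Ln; rewrite ifF//; lia.
Qed.

Lemma circle_val_sum A :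
  \sum_(1 <= j < n.+2) circle_val j A = n.+1%:R - #|A|%:R.
Proof.
have [->|[x xA]] := set_0Vmem A.
  under eq_bigr do rewrite circle_val0.
  rewrite cards0 subr0 big_nat_recr//= {2}/gamma_circle eqxx.
  rewrite big_nat (eq_bigr (gamma_circle_off f gamma n.+1)); last first.
    by move=> j /andP[_ jn]; rewrite /gamma_circle ltn_eqF.
  by rewrite -big_nat addrC subrK.
under eq_bigr do rewrite (circle_valE _ xA).
rewrite sum_run_gamma_free//.
rewrite -(@card_free (cut x)); last by move=> y z /cut_inj E; apply/val_inj/E.
by rewrite big_ord_recr/= cut_last xA addn0.
Qed.

(** Once a site [x] is taken, a request starting at [x] is refused and the other
    ones behave as on the line of the remaining [n] sites. *)
Lemma circle_jump_taken x j A : (1 <= j)%N -> x \in A ->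
  jump_sum m f (@circle_fits n.+1) (@circle_zone n.+1) (circle_val j) A =
  (n.+1%:R - exponent f j) * circle_val j A.
Proof.
move=> j1 xA; rewrite jump_sumE mulrBl -mulNr; congr (_ + _).
rewrite (circle_valE _ xA) -run_sum_scale.
rewrite -(@eq_run_sum _ _ _ _ _ (fun L _ => run_gen_gamma hf hgamma L j1)).
rewrite -list_genE ?(pmf0 hf) ?run_gamma0//.
rewrite /list_gen size_mkseq.
have cI : injective (fun y : 'I_n.+1 => cut x y).
  by move=> y z /cut_inj E; apply/val_inj/E.
rewrite (reindex_inj cI)/= big_ord_recr/= [X in _ + X]big1 ?addr0; last first.
  move=> k _; have [->|k0] := posnP k; first by rewrite (pmf0 hf) !mul0r.
  rewrite /serve/= ifF ?(circle_valE _ xA) ?subrr ?mulr0//.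
  apply/negP => /andP[_ /pred0P/(_ x)]; rewrite /= circle_zoneE xA andbT.
  move=> /negbT/existsP; apply; exists (Ordinal k0).
  by rewrite addn0 cut_last.
apply: eq_bigr => i _; apply: eq_bigr => k _.
have [->|k0] := posnP k; first by rewrite (pmf0 hf) !mul0r.
congr (_ * _).
have -> : circle_val j (serve (@circle_fits n.+1) (@circle_zone n.+1) A
    (cut x i, nat_of_ord k)) = run_sum (run_gamma gamma j) 0
  (free_list (cut x) n (serve (@circle_fits n.+1) (@circle_zone n.+1) A
    (cut x i, nat_of_ord k))).
  apply: circle_valE; rewrite /serve; case: ifP => // _.
  by rewrite inE xA.
have in_n y : avail (free_list (cut x) n A) i k -> (y < i + k)%N -> (y < n)%N.
  move=> /availP h yik; have [yi|iy] := ltnP y i; first by have := ltn_ord i; lia.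
  rewrite ltnNge; apply/negP => ny; have := h y.
  by rewrite nth_default ?size_mkseq// iy yik => /(_ isT).
rewrite -(@run_sum_serve _ _ _ (@circle_fits n.+1) (@circle_zone n.+1)) //.
- apply/andP/idP => [[_ /pred0P dA]|av].
    have dA' y : (i <= y < i + k)%N -> cut x y \notin A.
      move=> yik; have := dA (cut x y); rewrite /= circle_zoneE => /negbT.
      apply: contra => ->; rewrite andbT; apply/existsP.
      have yk : (y - i < k)%N by lia.
      by exists (Ordinal yk) => /=; rewrite subnKC//; lia.
    apply/availP => y yik; have yn : (y < n)%N.
      rewrite ltnNge; apply/negP => ny.
      have := dA' n; rewrite cut_last xA => /(_ _)/negP; apply=> //.
      by have := ltn_ord i; lia.
    by rewrite nth_mkseq// dA'.
  split; first by have := in_n (i + k.-1)%N av; rewrite /circle_fits; lia.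
  apply/pred0P => l /=; rewrite circle_zoneE; apply/negP.
  move=> /andP[/existsP[z /eqP ->]]; apply/negP.
  have zn : (i + z < n)%N by apply: (in_n _ av); rewrite ltn_add2l.
  move/availP: av => /(_ (i + z)%N); rewrite nth_mkseq//; apply.
  by rewrite leq_addr ltn_add2l/=.
- move=> av z zn; rewrite circle_zoneE; apply/existsP/idP => [[y /eqP/cut_inj E]|zik].
    have yn : (i + y < n)%N by apply: (in_n _ av); rewrite ltn_add2l.
    have {}E := E (ltnW zn) (ltnW yn).
    by rewrite E leq_addr ltn_add2l/=.
  have zk : (z - i < k)%N by lia.
  by exists (Ordinal zk) => /=; rewrite subnKC//; lia.
Qed.

(** From the empty circle a request of size [k] leaves one run of length
    [n.+1 - k], wherever it starts. *)
Lemma circle_jump_empty j : (1 <= j)%N -> (m <= n.+1)%N ->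
  jump_sum m f (@circle_fits n.+1) (@circle_zone n.+1) (circle_val j) finset.set0 =
  n.+1%:R * \sum_(k < m.+1) f k * run_gamma gamma j (n.+1 - k).
Proof.
move=> j1 mn; rewrite /jump_sum.
rewrite (eq_bigr (fun=> \sum_(k < m.+1) f k * run_gamma gamma j (n.+1 - k))).
  by rewrite sumr_const card_ord mulr_natl.
move=> i _; apply: eq_bigr => k _.
have [->|k0] := posnP k; first by rewrite (pmf0 hf) !mul0r.
congr (_ * _); rewrite /serve/= ifT; last first.
  rewrite /circle_fits; apply/andP; split; first by have := ltn_ord k; lia.
  by apply/pred0P => l /=; rewrite finset.in_set0 andbF.
(* The site i is written as the last site of its own cut, so that the zone
   i, i+1, ... has indices n, n+1, ... and wraps around to 0, 1, ... *)
rewrite finset.set0U -{1}(cut_last i).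
have iz : i \in circle_zone (cut i n) k.
  by rewrite circle_zoneE; apply/existsP; exists (Ordinal k0); rewrite addn0 cut_last.
rewrite (circle_valE _ iz).
have kn : (k <= n.+1)%N by have := ltn_ord k; lia.
have -> : free_list (cut i) n (circle_zone (cut i n) k) =
    nseq k.-1 false ++ nseq (n.+1 - k) true.
  apply: (@eq_from_nth _ false).
    by rewrite size_mkseq size_cat !size_nseq; lia.
  move=> y; rewrite size_mkseq => yn; rewrite nth_mkseq// nth_cat !nth_nseq.
  rewrite size_nseq circle_zoneE.
  have [yk|yk] := ltnP y k.-1.
    apply/negbTE; rewrite negbK; apply/existsP.
    have yk' : (y.+1 < k)%N by lia.
    exists (Ordinal yk') => /=.
    by rewrite addnS -addSn cut_periodic.
  rewrite ifT; last by lia.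
  apply/existsP => -[z /eqP]; have := ltn_ord z.
  case: (nat_of_ord z) => [|z'] zk.
    by rewrite addn0 => /cut_inj; lia.
  by rewrite addnS -addSn cut_periodic => /cut_inj; lia.
rewrite run_sum_nseq_false ?run_gamma0// -[nseq (n.+1 - k) true]cats0.
by rewrite run_sum_nseq_true.
Qed.

(** At the empty state the eigenvalue equation determines [gamma_circle]; it can be
    solved because [exponent f j <= j < n.+1]. *)
Lemma circle_val_eigen j A : (1 <= j <= n.+1)%N -> (m <= n.+1)%N ->
  jump_sum m f (@circle_fits n.+1) (@circle_zone n.+1) (circle_val j) A =
  (n.+1%:R - circle_rate j) * circle_val j A.
Proof.
move=> /andP[j1 jn] mn; have [->|[x xA]] := set_0Vmem A; last first.
  rewrite (circle_jump_taken j1 xA) /circle_rate; case: eqP => // ->.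
  by rewrite (circle_val_top xA) !mulr0.
rewrite circle_jump_empty// circle_val0 /circle_rate /gamma_circle.
case: eqP => [->|/eqP jn'].
  rewrite subrr mul0r big1 ?mulr0// => k _.
  have [->|k0] := posnP k; first by rewrite (pmf0 hf) !mul0r.
  by rewrite /run_gamma ifF ?mulr0//; lia.
have {}jn : (j < n.+1)%N by rewrite ltn_neqAle jn'.
rewrite /gamma_circle_off -/(exponent f j).
have n0 : n.+1%:R != 0 :> R by rewrite pnatr_eq0.
have d0 : n.+1%:R - exponent f j != 0.
  rewrite subr_eq0 eq_sym; apply/negP => /eqP E.
  by have := exponent_le hf j; rewrite E ler_nat leqNgt jn.
have -> : \sum_(k < m.+1) f k * run_gamma gamma j (n.+1 - k) =
    \sum_(1 <= k < (n.+1 - j).+1) f k * gamma (n.+1 - k)%N j.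
  transitivity (\sum_(k < n.+2) f k * run_gamma gamma j (n.+1 - k)).
    rewrite (big_ord_widen _ (fun k => f k * run_gamma gamma j (n.+1 - k))
      (_ : (m.+1 <= n.+2)%N))// [LHS]big_mkcond/=; apply: eq_bigr => k _.
    case: ltnP => // mk; suff -> : f k = 0 by rewrite mul0r.
    by case: hf => _ + _; apply; lia.
  rewrite big_ord_recl/= (pmf0 hf) mul0r add0r big_add1/= big_mkord.
  rewrite (big_ord_widen _ (fun k => f k.+1 * gamma (n.+1 - k.+1)%N j)
    (leq_subr j n.+1)) [RHS]big_mkcond/=; apply: eq_bigr => k _.
  rewrite /run_gamma /bump/= add1n j1/=.
  have -> : (j <= n.+1 - k.+1)%N = (k < n.+1 - j)%N by have := ltn_ord k; lia.
  by case: ifP => // _; rewrite mulr0.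
under [in RHS]eq_bigr do rewrite mulrA.
rewrite -mulr_suml [X in _ = X]mulrCA mulrC; congr (_ * _).
move: n0 d0; move: (n.+1%:R : R) => N n0 d0.
by field; rewrite n0 d0.
Qed.

End eigenfunctions.

(** * Limits and integrals *)

Section limits.
Context {R : realType}.

(** With [y = z / N.+1], the inequality [expR (- y) >= 1 - y] gives
    [1 + y >= expR y * (1 - y ^+ 2)], and the error is controlled by the Bernoulli
    inequality. *)
Lemma exprn_1D_lower (z : R) (N : nat) : 0 <= z -> z <= N.+1%:R ->
  expR z * (1 - z ^+ 2 / N.+1%:R) <= (1 + z / N.+1%:R) ^+ N.+1.
Proof.
move=> z0 zN; have N0 : 0 < N.+1%:R :> R by rewrite ltr0n.
set y := z / N.+1%:R.
have y0 : 0 <= y by rewrite divr_ge0// ltW.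
have y1 : y <= 1 by rewrite ler_pdivrMr ?mul1r.
have bernoulli (a : R) k : 0 <= a <= 1 -> 1 - k%:R * a <= (1 - a) ^+ k.
  move=> /andP[a0 a1]; elim: k => [|k IH]; first by rewrite mul0r subr0 expr0.
  rewrite exprS; apply: (le_trans _ (ler_wpM2l _ IH)); last by rewrite subr_ge0.
  rewrite -natr1; have k0 : 0 <= k%:R :> R by rewrite ler0n.
  have := mulr_ge0 (mulr_ge0 k0 a0) a0; nra.
have step : expR y * (1 - y ^+ 2) <= 1 + y.
  have -> : 1 + y = expR y * ((1 + y) * expR (- y)).
    by rewrite mulrCA -expRD subrr expR0 mulr1.
  rewrite ler_wpM2l ?expR_ge0//.
  have := expR_ge1Dx (- y); nra.
have -> : expR z = expR y ^+ N.+1.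
  by rewrite -expRM_natl /y mulrC divfK// lt0r_neq0.
have -> : z ^+ 2 / N.+1%:R = N.+1%:R * y ^+ 2.
  by rewrite /y; field; rewrite lt0r_neq0.
apply: (@le_trans _ _ (expR y ^+ N.+1 * (1 - y ^+ 2) ^+ N.+1)).
  rewrite ler_wpM2l ?exprn_ge0 ?expR_ge0//; apply: bernoulli.
  by rewrite exprn_ge0//= expr_le1.
rewrite -exprMn; apply: lerXn2r => //; rewrite nnegrE; last by lra.
by rewrite mulr_ge0 ?expR_ge0// subr_ge0 expr_le1.
Qed.

Lemma exprn_1D_upper (z : R) (N : nat) : 0 <= z ->
  (1 + z / N.+1%:R) ^+ N.+1 <= expR z.
Proof.
move=> z0; have N0 : 0 < N.+1%:R :> R by rewrite ltr0n.
have -> : expR z = expR (z / N.+1%:R) ^+ N.+1.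
  by rewrite -expRM_natl mulrC divfK// lt0r_neq0.
have y0 : 0 <= z / N.+1%:R by rewrite divr_ge0// ltW.
by apply: lerXn2r; rewrite ?nnegrE ?expR_ge0 ?expR_ge1Dx// addr_ge0.
Qed.

Lemma cvg_exprn_1D (z : R) : 0 <= z ->
  (1 + z / N.+1%:R) ^+ N.+1 @[N --> \oo] --> expR z.
Proof.
move=> z0; apply: (@squeeze_cvgr _ _ _ _
  (fun N => expR z * (1 - z ^+ 2 / N.+1%:R)) (fun=> expR z)).
- near=> N; rewrite exprn_1D_upper// andbT exprn_1D_lower//.
  near: N; exists (Num.bound z) => // N /= bN.
  rewrite (le_trans (ltW (archi_boundP z0)))// ler_nat.
  exact: leqW.
- have : expR z * (1 - z ^+ 2 / N.+1%:R) @[N --> \oo] -->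
      expR z * (1 - z ^+ 2 * 0).
    apply: cvgM; first exact: cvg_cst.
    apply: cvgB; first exact: cvg_cst.
    apply: cvgM; first exact: cvg_cst.
    exact: cvg_harmonic.
  by rewrite mulr0 subr0 mulr1.
- exact: cvg_cst.
Unshelve. all: by end_near. Qed.

(** The limit of the multiplier of an eigenfunction over [N.+1] cells, see
    [sum_histories]. *)
Lemma cvg_step_factor (a b s : R) : 0 <= s -> 0 <= a - b ->
  (expR (- (a * (s / N.+1%:R))) * (1 + s / N.+1%:R * (a - b))) ^+ N.+1
    @[N --> \oo] --> expR (- (b * s)).
Proof.
move=> s0 ab.
have -> : expR (- (b * s)) = expR (- (a * s)) * expR (s * (a - b)).
  by rewrite -expRD; congr expR; ring.
rewrite (_ : (fun N => _) = (fun N => expR (- (a * s)) *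
  (1 + s * (a - b) / N.+1%:R) ^+ N.+1)).
  by apply: cvgM; [exact: cvg_cst|apply: cvg_exprn_1D; exact: mulr_ge0].
apply/funext => N; rewrite exprMn -expRM_natl; congr (expR _ * (1 + _) ^+ _).
  have : N.+1%:R != 0 :> R by rewrite pnatr_eq0.
  by move: (N.+1%:R : R) => c c0; field.
by ring.
Qed.

End limits.

Section sandwich.
Context d (Omega : measurableType d) (R : realType) (P : probability Omega R).
Local Open Scope ereal_scope.

(** The integral of a nonnegative function is a supremum over the simple functions
    below it, so monotonicity holds even for nonmeasurable functions; this is how
    the number of picked packages is handled. *)
Lemma ge0_le_integralT (X Y : Omega -> \bar R) :
  (forall w, 0 <= X w) -> (forall w, X w <= Y w) ->
  \int[P]_w X w <= \int[P]_w Y w.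
Proof.
move=> X0 XY; rewrite !ge0_integralTE//; last first.
  by move=> w; exact: le_trans (X0 w) (XY w).
apply: le_ereal_sup => _ [h hX <-]; exists h => // w.
exact: le_trans (hX w) (XY w).
Qed.

Lemma measurable_scale_indic (c : R) (A : set Omega) : measurable A ->
  measurable_fun setT (fun w => c * \1_A w)%R.
Proof.
move=> mA; apply: measurable_funM; first exact: measurable_cst.
exact: measurable_indic.
Qed.

Lemma integral_step (I : finType) (E : I -> set Omega) (p g : I -> R) :
  (forall i, measurable (E i)) -> (forall i, P (E i) = (p i)%:E) ->
  (forall i, (0 <= g i)%R) ->
  \int[P]_w (\sum_i g i * \1_(E i) w)%:E = (\sum_i g i * p i)%:E.
Proof.
move=> mE PE g0; under eq_integral do rewrite -sumEFin.
rewrite ge0_integral_sum//=; last 2 first.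
- by move=> i; apply/measurable_EFinP; exact: measurable_scale_indic.
- by move=> i w _; rewrite lee_fin mulr_ge0.
rewrite -sumEFin; apply: eq_bigr => i _.
under eq_integral do rewrite EFinM.
rewrite ge0_integralZl//; last 2 first.
- by apply/measurable_EFinP; exact: measurable_indic.
- by rewrite lee_fin.
by rewrite integral_indic// setIT EFinM; congr (_ * _); exact: PE.
Qed.

(** [X] is bounded below by the simple function equal to [g i] on [E i], and above by
    the same function plus [M] on the complement of the union of the [E i]. *)
Lemma integral_sandwich (I : finType) (E : I -> set Omega) (p g : I -> R)
    (X : Omega -> R) (M : R) :
  (forall i, measurable (E i)) -> (forall i, P (E i) = (p i)%:E) ->
  (forall i j w, E i w -> E j w -> i = j) ->
  (forall i w, E i w -> X w = g i) ->
  (forall i, (0 <= g i)%R) -> (forall w, (0 <= X w <= M)%R) ->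
  (\sum_i g i * p i)%:E <= \int[P]_w (X w)%:E <=
    (\sum_i g i * p i + M * (1 - \sum_i p i))%:E.
Proof.
move=> mE PE disj XE g0 XM.
have stepE (c : I -> R) i w : E i w -> (\sum_j c j * \1_(E j) w)%R = c i.
  move=> Ei; rewrite (bigD1 i)//= indicE mem_set// mulr1 big1 ?addr0// => j ji.
  rewrite indicE memNset ?mulr0// => Ej; move: ji.
  by rewrite (disj _ _ _ Ei Ej) eqxx.
have step0 (c : I -> R) w : ~ (exists i, E i w) ->
    (\sum_j c j * \1_(E j) w)%R = 0%R.
  move=> nE; rewrite big1// => j _; rewrite indicE memNset ?mulr0// => Ej.
  by apply: nE; exists j.
apply/andP; split.
  rewrite -(integral_step mE PE g0); apply: ge0_le_integralT => w.
    by rewrite lee_fin sumr_ge0// => i _; rewrite mulr_ge0.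
  rewrite lee_fin; have [[i Ei]|nE] := pselect (exists i, E i w).
    by rewrite (stepE _ _ _ Ei) (XE _ _ Ei).
  by rewrite step0//; case/andP: (XM w).
have [w0 _] : (exists w : Omega, True).
  apply: contrapT => nw; have := probability_setT P.
  rewrite (_ : setT = set0) ?measure0; last first.
    by apply/seteqP; split => // w _; apply: nw; exists w.
  by case=> /esym/eqP; rewrite oner_eq0.
have M0 : (0 <= M)%R by have /andP[] := XM w0; exact: le_trans.
pose U := \bigcup_(i in [set: I]) E i.
have UP w : U w <-> exists i, E i w.
  by split=> [[i _ Ei]|[i Ei]]; exists i.
have mU : measurable U.
  by apply: fin_bigcup_measurable => // ; exact: finite_finset.
have PU : P U = (\sum_i p i)%:E.
  transitivity (\int[P]_w (\sum_i 1 * \1_(E i) w)%:E).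
    rewrite -[in LHS](setIT U) -integral_indic//; apply: eq_integral => w _.
    congr (_%:E); have [[i Ei]|nE] := pselect (exists i, E i w).
      by rewrite (stepE _ _ _ Ei) indicE mem_set//; apply/UP; exists i.
    by rewrite step0// indicE memNset// => /UP.
  rewrite (integral_step mE PE)//; congr (_%:E).
  by apply: eq_bigr => i _; rewrite mul1r.
have PUC : P (~` U) = (1 - \sum_i p i)%:E.
  by rewrite probability_setC// PU.
have -> : (\sum_i g i * p i + M * (1 - \sum_i p i))%:E =
    \int[P]_w ((\sum_i g i * \1_(E i) w)%:E + (M * \1_(~` U) w)%:E).
  rewrite ge0_integralD//=; last 4 first.
  - by move=> w _; rewrite lee_fin sumr_ge0// => i _; rewrite mulr_ge0.
  - apply/measurable_EFinP; apply: measurable_sum => i.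
    exact: measurable_scale_indic.
  - by move=> w _; rewrite lee_fin mulr_ge0.
  - apply/measurable_EFinP; apply: measurable_scale_indic.
    exact: measurableC.
  rewrite (integral_step mE PE)// EFinD; congr (_ + _).
  under eq_integral do rewrite EFinM.
  rewrite ge0_integralZl//; last first.
    by apply/measurable_EFinP; apply: measurable_indic; exact: measurableC.
  rewrite integral_indic ?setIT//; last exact: measurableC.
  by rewrite EFinM; congr (_ * _).
apply: ge0_le_integralT => w; first by rewrite lee_fin; case/andP: (XM w).
rewrite -EFinD lee_fin; have [[i Ei]|nE] := pselect (exists i, E i w).
  by rewrite (stepE _ _ _ Ei) (XE _ _ Ei) lerDl mulr_ge0.
rewrite step0// add0r indicE mem_set ?mulr1; last by move=> /UP.
by case/andP: (XM w).
Qed.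

End sandwich.

(** * Counting the points of one process *)

Section counting.
Context {R : realType}.
Implicit Types (tau : nat -> R) (s t : R).

(** Exactly the first [a] points are in [0, s].  This is easier to propagate from
    cell to cell than cardinals, and it identifies the next point. *)
Definition has_count tau s (a : nat) : Prop :=
  forall j, (tau j <= s) = (j < a)%N.

Lemma has_count_inj tau s a b : has_count tau s a -> has_count tau s b -> a = b.
Proof.
move=> ha hb; apply/eqP; rewrite eqn_leq; apply/andP; split.
  by case: a ha => // a ha; rewrite -hb ha.
by case: b hb => // b hb; rewrite -ha hb.
Qed.

Lemma has_count_exists tau s : (forall j, tau j < tau j.+1) ->
  tau j @[j --> \oo] --> +oo -> exists a, has_count tau s a.
Proof.
move=> incr /cvgryPgt/(_ s)[N _ hN].
have mono : {homo tau : i j / (i <= j)%N >-> i <= j}.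
  by apply: homo_leq => // [x y z|j]; [exact: le_trans|exact: ltW].
have exN : exists j, s < tau j by exists N; exact: hN (leqnn N).
exists (ex_minn exN); case: ex_minnP => a sa amin j.
case: (ltnP j a) => ja.
  by rewrite leNgt; apply/negP => /amin; rewrite leqNgt ja.
by apply/negbTE; rewrite -ltNge (lt_le_trans sa)// mono.
Qed.

Lemma card_has_count tau s t a b : (a <= b)%N ->
  has_count tau s a -> has_count tau t b ->
  #|` fset_set [set j | s < tau j <= t]| = (b - a)%N.
Proof.
move=> ab ha hb.
have -> : [set j | s < tau j <= t] = [set` iota a (b - a)].
  apply/seteqP; split => j /=; rewrite mem_iota subnKC// ltNge ha hb -leqNgt//.
have -> : fset_set [set` iota a (b - a)] = seq_fset tt (iota a (b - a)).
  apply/fsetP => j; rewrite in_fset_set; last exact: finite_seq.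
  rewrite (seq_fsetE tt).
  by apply/idP/idP; rewrite inE.
by rewrite size_seq_fset undup_id ?iota_uniq// size_iota.
Qed.

Lemma has_count_le tau s t a b : s <= t ->
  has_count tau s a -> has_count tau t b -> (a <= b)%N.
Proof.
move=> st ha hb; case: a ha => // a ha; rewrite -hb.
by rewrite (le_trans _ st)// ha.
Qed.

Lemma card_points_eqP tau s t a k : s <= t -> (forall j, tau j < tau j.+1) ->
  tau j @[j --> \oo] --> +oo -> has_count tau s a ->
  #|` fset_set [set j | s < tau j <= t]| = k <-> has_count tau t (a + k).
Proof.
move=> st incr infty ha; have [b hb] := has_count_exists t incr infty.
have ab := has_count_le st ha hb.
rewrite (card_has_count ab ha hb); split=> [<-|hk]; first by rewrite subnKC.
by rewrite (has_count_inj hb hk) addKn.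
Qed.

End counting.

(** The following is stated for an arbitrary sigma-algebra [S], because it is applied
    both to the ambient one and to the one generated by a single process. *)
Section count_events.
Context {R : realType} (T : Type) (S : set_system T) (tau : nat -> T -> R).
Hypotheses (hS : sigma_algebra setT S) (Stau : forall j s, S [set w | tau j w <= s]).

Let S_setC A : S A -> S (~` A).
Proof. by case: hS => _ SC _ /SC; rewrite setTD. Qed.

Let S_bigcup (F : nat -> set T) : (forall k, S (F k)) -> S (\bigcup_k F k).
Proof. by case: hS => _ _; apply. Qed.

Lemma sigma_bigcap (F : nat -> set T) :
  (forall k, S (F k)) -> S (\bigcap_k F k).
Proof.
move=> SF; rewrite -[X in S X]setCK setC_bigcap.
by apply: S_setC; apply: S_bigcup => k; exact: S_setC.
Qed.

Lemma sigma_setI A B : S A -> S B -> S (A `&` B).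
Proof.
move=> SA SB; rewrite -bigcap2E; apply: sigma_bigcap => -[|[|k]] //=.
by case: hS => S0 _ _; rewrite -setC0; exact: S_setC.
Qed.

Lemma sigma_has_count s a : S [set w | has_count (tau ^~ w) s a].
Proof.
have -> : [set w | has_count (tau ^~ w) s a] =
    \bigcap_j [set w | (tau j w <= s) = (j < a)%N].
  by apply/seteqP; split => w /= h j; [move=> _; exact: h|exact: (h j I)].
apply: sigma_bigcap => j; case: (j < a)%N.
  by rewrite (_ : [set w | _] = [set w | tau j w <= s]).
rewrite (_ : [set w | _] = ~` [set w | tau j w <= s]); first exact: S_setC.
by apply/seteqP; split => w /= => [->|/negP/negbTE].
Qed.

Hypothesis incr : forall j w, tau j w < tau j.+1 w.
Hypothesis infty : forall w, tau j w @[j --> \oo] --> +oo.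

Lemma sigma_card_points s t k : s <= t ->
  S [set w | #|` fset_set [set j | s < tau j w <= t]| = k].
Proof.
move=> st; have -> : [set w | #|` fset_set [set j | s < tau j w <= t]| = k] =
    \bigcup_a ([set w | has_count (tau ^~ w) s a] `&`
               [set w | has_count (tau ^~ w) t (a + k)]).
  apply/seteqP; split => w /=.
    have [a ha] := has_count_exists s (incr ^~ w) (infty w).
    by move=> /(card_points_eqP _ st (incr ^~ w) (infty w) ha) hk; exists a.
  by move=> [a _ [/= ha /(card_points_eqP _ st (incr ^~ w) (infty w) ha)]].
by apply: S_bigcup => a; apply: sigma_setI; exact: sigma_has_count.
Qed.

End count_events.

(** * Histories *)

(** A history describes successive time cells, the most recent one being at the head
    of the list: [None] is a cell without points, [Some (i, k)] a cell with exactly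
    one point, at location [i] and of mark [k]. *)
Section histories.
Context (n m : nat).
Implicit Types (x : seq (option ('I_n * 'I_m.+1))) (i : 'I_n).
Implicit Types (o : option ('I_n * 'I_m.+1)) (q : 'I_n * nat).

Definition hit o i : nat := if o is Some c then c.1 == i else 0.

Fixpoint cnt x i : nat := if x is o :: x' then (hit o i + cnt x' i)%N else 0.

(** The points [(i, j)] of the processes named by the history, the latest first: the
    point of a cell at location [i] has as index the number of earlier points
    there. *)
Fixpoint keys x : seq ('I_n * nat) :=
  match x with
  | [::] => [::]
  | None :: x' => keys x'
  | Some c :: x' => (c.1, cnt x' c.1) :: keys x'
  end.

Fixpoint mark x q : nat :=
  match x with
  | [::] => 0
  | None :: x' => mark x' q
  | Some c :: x' => if q == (c.1, cnt x' c.1) then nat_of_ord c.2 else mark x' q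
  end.

Fixpoint state fits zone x : {set 'I_n} :=
  match x with
  | [::] => finset.set0
  | None :: x' => state fits zone x'
  | Some c :: x' => serve fits zone (state fits zone x') (c.1, nat_of_ord c.2)
  end.

Lemma mem_keys x q : (q \in keys x) = (q.2 < cnt x q.1)%N.
Proof.
elim: x => [//|[[i k]|] x IH] //=; rewrite inE IH; case: q {IH} => i' j /=.
rewrite xpair_eqE /= eq_sym; case: eqP => [->|_] //=.
by rewrite add1n ltnS [RHS]leq_eqVlt.
Qed.

Lemma keys_uniq x : uniq (keys x).
Proof. by elim: x => [//|[[i k]|] x IH] //=; rewrite mem_keys/= ltnn. Qed.

Lemma mark_cons i (k : 'I_m.+1) x q :
  q \in keys x -> mark (Some (i, k) :: x) q = mark x q.
Proof.
by rewrite mem_keys /= => qx; case: eqP => // E; move: qx; rewrite E /= ltnn.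
Qed.

Lemma foldl_keys fits zone x (b : 'I_n * nat -> nat) :
  (forall q, q \in keys x -> b q = mark x q) ->
  foldl (serve fits zone) finset.set0 [seq (q.1, b q) | q <- rev (keys x)] =
  state fits zone x.
Proof.
rewrite map_rev foldl_rev; elim: x => [//|[[i k]|] x IH] h //=; last exact: IH.
rewrite IH => [|q qx]; last by rewrite h ?mark_cons//= inE qx orbT.
by rewrite h ?inE ?eqxx//= eqxx.
Qed.

(** A product over the distinct marks read by a history, as provided by independence,
    is a product over its cells. *)
Lemma prod_marks (A : comNzRingType) (f : nat -> A) x :
  \prod_(q <- keys x) f (mark x q) =
  \prod_(o <- x) (if o is Some c then f c.2 else 1).
Proof.
elim: x => [|[[i k]|] x IH] /=; rewrite ?big_nil ?big_cons// -?IH ?mul1r//=.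
rewrite eqxx; congr (_ * _); rewrite big_seq [RHS]big_seq.
by apply: eq_bigr => q qx; congr f; exact: (mark_cons i k qx).
Qed.

Context d (Omega : measurableType d) (R : realType).
Variables (T : 'I_n -> nat -> Omega -> R) (B : 'I_n -> nat -> Omega -> nat).
Variable u : nat -> R.

Definition cells_event x i : set Omega :=
  [set w | forall l, (l < size x)%N ->
     npoints (T i) (u l) (u l.+1) w = hit (nth None (rev x) l) i].

Definition history_event x : set Omega :=
  [set w | (forall i, cells_event x i w) /\
           (forall q, q \in keys x -> B q.1 q.2 w = mark x q)].

Lemma cells_event_cons o x i w : cells_event (o :: x) i w ->
  cells_event x i w /\ npoints (T i) (u (size x)) (u (size x).+1) w = hit o i.
Proof.
move=> h; split=> [l lx|].
  by rewrite h//= ?ltnS 1?ltnW// rev_cons nth_rcons size_rev lx.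
by rewrite h//= rev_cons nth_rcons size_rev ltnn eqxx.
Qed.

Lemma history_event_cons o x w : history_event (o :: x) w ->
  history_event x w.
Proof.
move=> [hc hm]; split=> [i|q qx]; first by have [] := cells_event_cons (hc i).
case: o hm {hc} => [[i k]|] hm; last exact: hm.
by rewrite hm ?(mark_cons i k qx)//= inE qx orbT.
Qed.

(** The counts determine in which cells and where there are points, and the marks of
    these points are then read off at the same indices. *)
Lemma history_event_inj x y w : size x = size y ->
  history_event x w -> history_event y w -> x = y.
Proof.
elim: x y => [|o x IH] [|o' y]//= [xy] hx hy.
have {}IH := IH _ xy (history_event_cons hx) (history_event_cons hy).
rewrite -{y xy}IH in hy *; congr (_ :: _).
have hit_eq i : hit o i = hit o' i.
  have [_ <-] := cells_event_cons (hx.1 i).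
  by have [_ <-] := cells_event_cons (hy.1 i).
case: o o' hx hy hit_eq => [[i k]|] [[i' k']|] hx hy hit_eq //.
- have ii : i' = i.
    by have := hit_eq i; rewrite /= eqxx; case: eqP.
  rewrite {}ii in hy *; congr (Some (_, _)); apply: val_inj => /=.
  have := hx.2 (i, cnt x i); rewrite /= inE eqxx => /(_ isT) <-.
  by have := hy.2 (i, cnt x i); rewrite /= inE eqxx => /(_ isT) <-.
- by have := hit_eq i; rewrite /= eqxx.
- by have := hit_eq i'; rewrite /= eqxx.
Qed.

Hypotheses (T_gt0 : forall i j w, 0 < T i j w)
  (T_incr : forall i j w, T i j w < T i j.+1 w)
  (T_infty : forall i w, T i j w @[j --> \oo] --> +oo).
Hypotheses (u0 : u 0%N = 0) (u_incr : forall l, u l <= u l.+1).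

Lemma history_count x w i : history_event x w ->
  has_count (T i ^~ w) (u (size x)) (cnt x i).
Proof.
elim: x => [_ j|o x IH hx] /=; first by rewrite u0 leNgt T_gt0.
have [_ E] := cells_event_cons (hx.1 i).
have := IH (history_event_cons hx); rewrite addnC.
move/(card_points_eqP _ (u_incr _) (fun j => T_incr i j w) (T_infty i w)) => H.
exact/H.
Qed.

Lemma history_key_le x w q : history_event x w ->
  (q \in keys x) = (T q.1 q.2 w <= u (size x)).
Proof. by move=> hx; rewrite (history_count q.1 hx) mem_keys. Qed.

Lemma history_keys_sorted x w : history_event x w ->
  sorted (fun p q => T q.1 q.2 w < T p.1 p.2 w) (keys x).
Proof.
elim: x => [//|[[i k]|] x IH] hx; have hx' := history_event_cons hx;
  last exact: IH.
rewrite /= path_min_sorted ?IH//; apply/allP => q; rewrite /=.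
rewrite (history_key_le _ hx') => qx; apply: (le_lt_trans qx).
by rewrite ltNge (history_count i hx') ltnn.
Qed.

(** The list [keys x] has the right points by [history_key_le] and is strictly
    decreasing in time, since each cell contributes at most one point.  Hence there
    are no ties, and the chronological sort can only return its reversal. *)
Lemma points_upto_history x w : history_event x w ->
  points_upto T (u (size x)) w = rev (keys x).
Proof.
move=> hx; rewrite /points_upto.
have setE : [set p : 'I_n * nat | T p.1 p.2 w <= u (size x)] = [set` keys x].
  by apply/seteqP; split => q /=; rewrite (history_key_le _ hx).
rewrite setE.
have fsetE : perm_eq (fset_set [set` keys x]) (rev (keys x)).
  apply: uniq_perm; rewrite ?rev_uniq ?keys_uniq ?fset_uniq// => q.
  rewrite in_fset_set; last exact: finite_seq.
  by rewrite mem_rev; apply/idP/idP; rewrite inE.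
set lt_rev := fun p q : 'I_n * nat => T p.1 p.2 w < T q.1 q.2 w.
have lt_tr : transitive lt_rev by move=> a b c; exact: lt_trans.
have srt : sorted lt_rev (rev (keys x)).
  by rewrite rev_sorted; exact: history_keys_sorted.
set le_rev := (X in sort X _).
have le_tr : transitive le_rev by move=> a b c; exact: le_trans.
rewrite -(sorted_sort le_tr (s := rev (keys x))); last first.
  by apply: sub_sorted srt => p q; exact: ltW.
apply/perm_sort_inP => //.
- by move=> p q _ _; exact: le_total.
- by move=> p q r _ _ _; exact: le_tr.
- move=> p q; rewrite !(perm_mem fsetE) => px qx /andP[pq qp].
  have E : T p.1 p.2 w = T q.1 q.2 w by apply/eqP; rewrite eq_le; apply/andP.
  apply/eqP; apply: contraT => npq.
  have [ij|ji] : (index p (rev (keys x)) < index q (rev (keys x)))%N \/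
                 (index q (rev (keys x)) < index p (rev (keys x)))%N.
    apply/orP; rewrite -neq_ltn; apply: contra npq => /eqP ii.
    by rewrite -(nth_index p px) ii nth_index.
  - have := sorted_ltn_index lt_tr srt _ _ px qx ij.
    by rewrite /lt_rev E ltxx.
  - have := sorted_ltn_index lt_tr srt _ _ qx px ji.
    by rewrite /lt_rev E ltxx.
Qed.

Lemma picked_history fits zone x w : history_event x w ->
  picked T B fits zone (u (size x)) w = state fits zone x.
Proof.
move=> hx; rewrite /picked points_upto_history//.
by rewrite (foldl_keys _ _ (b := fun q => B q.1 q.2 w))// => q /hx.2.
Qed.

End histories.

(** * Exact sums over all histories *)
Section step_sums.
Context {R : realType} (m : nat) (f : nat -> R) (n : nat).
Variables (fits : 'I_n -> nat -> bool) (zone : 'I_n -> nat -> {set 'I_n}).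
Implicit Types (A : {set 'I_n}) (v : {set 'I_n} -> R).

Definition step_state A (o : option ('I_n * 'I_m.+1)) : {set 'I_n} :=
  if o is Some c then serve fits zone A (c.1, nat_of_ord c.2) else A.

(** The probability of a cell, where [y] is [lambda] times its length: [n] independent
    Poisson variables of parameter [y] vanish with probability [expR (- (n * y))], and
    are the indicator of a given location with [y] times this probability. *)
Definition step_weight (y : R) (o : option ('I_n * 'I_m.+1)) : R :=
  expR (- (n%:R * y)) * (if o is Some c then y * f c.2 else 1).

Lemma sum_option (X : finType) (F : option X -> R) :
  \sum_o F o = F None + \sum_x F (Some x).
Proof.
rewrite (bigD1 None)//=; congr (_ + _).
rewrite (reindex_omap Some id) => [|[x|] //].
by apply: eq_bigl => x; rewrite /= eqxx.
Qed.

Lemma sum_step v y s A : jump_sum m f fits zone v A = (n%:R - s) * v A ->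
  \sum_o step_weight y o * v (step_state A o) =
  (expR (- (n%:R * y)) * (1 + y * (n%:R - s))) * v A.
Proof.
move=> vE; rewrite sum_option /step_weight /= mulr1 -mulrA mulrDl mul1r mulrDr.
congr (_ + _); rewrite -mulrA -vE mulrA /jump_sum pair_big/= mulr_sumr.
by apply: eq_bigr => c _; rewrite !mulrA.
Qed.

Lemma sum_tuple_cons (X : finType) N (F : N.+1.-tuple X -> R) :
  \sum_x F x = \sum_(x : N.-tuple X) \sum_(o : X) F [tuple of o :: x].
Proof.
rewrite pair_big/=.
rewrite (reindex (fun p : N.-tuple X * X => [tuple of p.2 :: p.1]))//.
exists (fun x : N.+1.-tuple X => ([tuple of behead x], thead x)).
  by move=> [x o] _ /=; rewrite theadE; congr (_, _); exact: val_inj.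
by move=> x _; rewrite /= -tuple_eta.
Qed.

(** Each cell multiplies an eigenfunction by the same factor. *)
Lemma sum_histories v y s N :
  (forall A, jump_sum m f fits zone v A = (n%:R - s) * v A) ->
  \sum_(x : N.-tuple (option ('I_n * 'I_m.+1)))
    (\prod_(o <- x) step_weight y o) * v (state fits zone x) =
  (expR (- (n%:R * y)) * (1 + y * (n%:R - s))) ^+ N * v finset.set0.
Proof.
move=> vE; elim: N => [|N IH].
  rewrite (eq_bigr (fun=> v finset.set0)) => [|x _].
    by rewrite sumr_const card_tuple expn0 mul1r.
  by rewrite tuple0 big_nil mul1r.
rewrite sum_tuple_cons exprS -mulrA -IH mulr_sumr; apply: eq_bigr => x _.
rewrite mulrCA -(sum_step y (vE _)) mulr_sumr; apply: eq_bigr => o _.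
by rewrite big_cons mulrCA mulrA; case: o.
Qed.

End step_sums.

(** * The law of a history *)
Section history_law.
Context (R : realType) (m n : nat) (f : nat -> R) (lambda : R).
Context d (Omega : measurableType d) (P : probability Omega R).
Context (T : 'I_n -> nat -> {RV P >-> R}) (B : 'I_n -> nat -> {RV P >-> nat}).
Hypotheses (hlambda : 0 < lambda) (hTB : request_model lambda f T B).
Variable h : R.
Hypothesis h0 : 0 < h.

Let u (l : nat) : R := l%:R * h.
Implicit Types (x : seq (option ('I_n * 'I_m.+1))) (i : 'I_n).

Let u_incr l : u l <= u l.+1.
Proof. by rewrite ler_pM2r// ler_nat. Qed.

Lemma sigma_cells_event (S : set_system Omega) x i : sigma_algebra setT S ->
  (forall j s, S [set w | T i j w <= s]) ->
  S (cells_event (fun i j => T i j : Omega -> R) u x i).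
Proof.
move=> hS ST; have [_ incr infty _ _] := model_times hTB i.
have -> : cells_event (fun i j => T i j : Omega -> R) u x i =
    \bigcap_l [set w | (l < size x)%N ->
      npoints (T i) (u l) (u l.+1) w = hit (nth None (rev x) l) i].
  by apply/seteqP; split => w /= hw l; [move=> _; exact: hw|exact: hw].
apply: (sigma_bigcap hS) => l; have [lx|xl] := ltnP l (size x).
  rewrite (_ : [set w | _] = [set w | npoints (T i) (u l) (u l.+1) w =
    hit (nth None (rev x) l) i]).
    exact: (sigma_card_points hS ST incr infty _ (u_incr l)).
  by apply/seteqP; split => w /=; [apply|].
rewrite (_ : [set w | _] = setT); last by apply/seteqP; split.
by rewrite -setC0 -setTD; case: hS => S0 SC _; exact: SC.
Qed.

Lemma cells_event_sigma_of_seq x i :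
  sigma_of_seq (T i) (cells_event (fun i j => T i j : Omega -> R) u x i).
Proof.
apply: sigma_cells_event; first exact: smallest_sigma_algebra.
move=> j s; apply: sub_sigma_algebra; exists j => //.
exists `]-oo, s]%classic; first exact: measurable_itv.
by rewrite setTI; apply/seteqP; split => w /=; rewrite in_itv.
Qed.

Lemma measurable_cells_event x i :
  measurable (cells_event (fun i j => T i j : Omega -> R) u x i).
Proof.
apply: sigma_cells_event; first exact: sigma_algebra_measurable.
move=> j s; rewrite -[X in measurable X]setTI.
rewrite (_ : [set w | _] = (T i j : Omega -> R) @^-1` `]-oo, s]%classic).
  by apply: measurable_funP.
by apply/seteqP; split => w /=; rewrite in_itv.
Qed.

(** Independence of the increments of one process over the cells. *)
Lemma cells_event_prob x i :
  P (cells_event (fun i j => T i j : Omega -> R) u x i) =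
  (\prod_(o <- x) poisson_pmf (lambda * h) (hit o i))%:E.
Proof.
have [_ _ _ inc indep] := model_times hTB i.
pose E l := [set w | npoints (T i) (u l) (u l.+1) w = hit (nth None (rev x) l) i].
pose J := seq_fset tt (iota 0 (size x)).
have -> : cells_event (fun i j => T i j : Omega -> R) u x i =
    \bigcap_(l in [set` J]) E l.
  apply/seteqP; split => w /= hw l.
    by rewrite /= (seq_fsetE tt) mem_iota add0n => /andP[_]; exact: hw.
  by move=> lx; apply: hw; rewrite /= (seq_fsetE tt) mem_iota.
rewrite (indep u); last 3 first.
- by rewrite /u mul0r.
- exact: u_incr.
- move=> l _; exists [set hit (nth None (rev x) l) i] => //.
  by rewrite setTI; apply/seteqP; split.
transitivity (\prod_(l <- J)
    (poisson_pmf (lambda * h) (hit (nth None (rev x) l) i))%:E)%E.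
  apply: eq_bigr => l _; rewrite inc; last first.
    by rewrite /u mulr_ge0 ?ler0n ?(ltW h0)//= ltr_pM2r// ltr_nat.
  by congr (poisson_pmf (_ * _) _)%:E; rewrite /u -mulrBl -natrB// subSnn mul1r.
rewrite prodEFin; congr (_%:E).
rewrite (perm_big (iota 0 (size x))); last first.
  by rewrite -[X in perm_eq _ X]undup_id ?iota_uniq// seq_fset_perm.
rewrite -[RHS](perm_big _ (introT permPl (perm_rev x))).
by rewrite [RHS](big_nth None) /index_iota subn0 size_rev.
Qed.

Lemma measurable_history_event x :
  measurable (history_event (fun i j => T i j : Omega -> R)
    (fun i j => B i j : Omega -> nat) u x).
Proof.
rewrite (_ : history_event _ _ _ _ =
    (\bigcap_(i in [set: 'I_n]) cells_event (fun i j => T i j : Omega -> R) u x i)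
    `&` \bigcap_(q in [set` keys x])
      ((B q.1 q.2 : Omega -> nat) @^-1` [set mark x q])).
  apply: measurableI; apply: fin_bigcap_measurable.
  - exact: finite_finset.
  - by move=> i _; exact: measurable_cells_event.
  - exact: finite_seq.
  - move=> q _; rewrite -[X in measurable X]setTI.
    by apply: measurable_funP.
by apply/seteqP; split => w /= [hc hm]; split => [i|q qx];
  [move=> _; exact: hc|exact: hm|exact: (hc i I)|exact: hm].
Qed.

Lemma prod_poisson_hit (o : option ('I_n * 'I_m.+1)) :
  \prod_(i < n) poisson_pmf (lambda * h) (hit o i) =
  expR (- (n%:R * (lambda * h))) * (if o is Some _ then lambda * h else 1).
Proof.
have y0 : 0 < lambda * h by exact: mulr_gt0.
rewrite (eq_bigr (fun i => expR (- (lambda * h)) *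
    (if hit o i == 0%N then 1 else lambda * h))); last first.
  move=> i _; rewrite /poisson_pmf y0 mulrC; congr (_ * _).
  case: o => [[i' k]|] /=; last by rewrite expr0 fact0 invr1 mulr1.
  by case: (i' == i); rewrite ?expr1 ?expr0 ?fact0 invr1 mulr1.
rewrite big_split/= prodr_const card_ord -expRM_natl mulrN; congr (_ * _).
case: o => [[i' k]|] /=; last by rewrite big1.
rewrite (bigD1 i')//= eqxx /= big1 ?mulr1// => i /negbTE.
by rewrite eq_sym => ->.
Qed.

(** Independence of the processes and of the marks.  The event involves all processes
    but only the marks of the points in [keys x], which depend on [x] alone and are
    pairwise distinct; so it is an intersection over a fixed finite set of
    indices. *)
Lemma history_event_prob x :
  P (history_event (fun i j => T i j : Omega -> R)
    (fun i j => B i j : Omega -> nat) u x) =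
  (\prod_(o <- x) step_weight f (lambda * h) o)%:E.
Proof.
pose E (z : 'I_n + 'I_n * nat) : set Omega :=
  match z with
  | inl i => cells_event (fun i j => T i j : Omega -> R) u x i
  | inr q => [set w | B q.1 q.2 w = mark x q]
  end.
pose s : seq ('I_n + 'I_n * nat) :=
  [seq inl i | i <- enum 'I_n] ++ [seq inr q | q <- keys x].
have s_uniq : uniq s.
  rewrite cat_uniq; apply/and3P; split.
  - by rewrite map_inj_uniq ?enum_uniq// => a b [].
  - by apply/hasPn => z /mapP[q _ ->]; apply/mapP => -[].
  - by rewrite map_inj_uniq ?keys_uniq// => a b [].
pose J := seq_fset tt s.
have -> : history_event (fun i j => T i j : Omega -> R)
    (fun i j => B i j : Omega -> nat) u x = \bigcap_(z in [set` J]) E z.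
  apply/seteqP; split => w /=.
    move=> [hc hm] z; rewrite /= (seq_fsetE tt) mem_cat.
    by move=> /orP[/mapP[i _ ->]|/mapP[q qx ->]]; [exact: hc|exact: hm].
  move=> hw; split=> [i|q qx].
    apply: (hw (inl i)); rewrite /= (seq_fsetE tt) mem_cat map_f ?mem_enum//.
  apply: (hw (inr q)); rewrite /= (seq_fsetE tt) mem_cat; apply/orP; right.
  exact: map_f.
rewrite (model_independent hTB); last first.
  move=> [i|[i j]] _; first exact: cells_event_sigma_of_seq.
  exists [set mark x (i, j)] => //.
  by rewrite setTI; apply/seteqP; split.
rewrite (perm_big s); last first.
  by rewrite -[X in perm_eq _ X]undup_id// seq_fset_perm.
rewrite /s big_cat !big_map/=.
under eq_bigr do rewrite cells_event_prob.
under [X in (_ * X)%E]eq_bigr do rewrite (model_marks hTB).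
rewrite !prodEFin -EFinM (prod_marks f); congr (_%:E).
rewrite -enumT big_enum/= exchange_big/= -big_split/=; apply: eq_bigr => o _.
by rewrite prod_poisson_hit /step_weight -mulrA; case: o => *; rewrite ?mulr1.
Qed.

End history_law.

(** * The expected number of picked packages *)
Section picked_expectation.
Context (R : realType) (m n : nat) (f : nat -> R) (lambda : R).
Context d (Omega : measurableType d) (P : probability Omega R).
Context (T : 'I_n -> nat -> {RV P >-> R}) (B : 'I_n -> nat -> {RV P >-> nat}).
Hypotheses (hlambda : 0 < lambda) (hTB : request_model lambda f T B).
Hypothesis hf : is_size_pmf m f.
Variables (fits : 'I_n -> nat -> bool) (zone : 'I_n -> nat -> {set 'I_n}).

Lemma picked0 w : picked T B fits zone 0 w = finset.set0.
Proof.
rewrite /picked /points_upto (_ : [set p | _] = set0) ?fset_set0//.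
apply/seteqP; split => // p /=.
by rewrite leNgt (poisson_points_gt0 (model_times hTB p.1)).
Qed.

Lemma jump_sum1 A : jump_sum m f fits zone (fun=> 1) A = (n%:R - 0) * 1.
Proof.
rewrite /jump_sum (eq_bigr (fun=> 1)); last first.
  by move=> i _; rewrite -mulr_suml mulr1 (pmf_sum1 hf).
by rewrite sumr_const card_ord subr0 mulr1.
Qed.

(** If the number of remaining packages is a sum of eigenfunctions [v j], its
    expectation is the sum of their initial values, each damped at its own rate.  For
    every [N] the expectation lies between its restriction [low N] to the histories
    of [N.+1] cells and [low N] plus [n] times the probability that no history
    occurs. *)
Lemma expected_picked_eigen (r : seq nat) (s : nat -> R)
    (v : nat -> {set 'I_n} -> R) (t : R) : 0 <= t ->
  (forall A, \sum_(j <- r) v j A = n%:R - #|A|%:R) ->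
  (forall j A, j \in r -> jump_sum m f fits zone (v j) A = (n%:R - s j) * v j A) ->
  (forall j, j \in r -> s j <= n%:R) ->
  expected_picked P T B fits zone t =
  (n%:R - \sum_(j <- r) v j finset.set0 * expR (- (lambda * s j * t)))%:E.
Proof.
move=> t0 vsum veig sn; rewrite /expected_picked unlock.
(* At time 0 the cells would be degenerate, but nothing has been picked up yet. *)
move: t0; rewrite le_eqVlt => /orP[/eqP <-|t0].
  under eq_bigr do rewrite mulr0 oppr0 expR0 mulr1.
  rewrite vsum cards0 subr0 subrr.
  by under eq_integral do rewrite picked0 cards0; rewrite integral0.
pose y N : R := lambda * (t / N.+1%:R).
pose rho N b : R := expR (- (n%:R * y N)) * (1 + y N * (n%:R - b)).
pose low N : R := n%:R * rho N 0 ^+ N.+1 -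
  \sum_(j <- r) rho N (s j) ^+ N.+1 * v j finset.set0.
pose high N : R := low N + n%:R * (1 - rho N 0 ^+ N.+1).
have bounds N : ((low N)%:E <= \int[P]_w (#|picked T B fits zone t w|%:R)%:E
    <= (high N)%:E)%E.
  have h0 : 0 < t / N.+1%:R by rewrite divr_gt0// ltr0n.
  pose u (l : nat) : R := l%:R * (t / N.+1%:R).
  pose E (x : N.+1.-tuple (option ('I_n * 'I_m.+1))) :=
    history_event (fun i j => T i j : Omega -> R)
      (fun i j => B i j : Omega -> nat) u x.
  pose p (x : N.+1.-tuple (option ('I_n * 'I_m.+1))) : R :=
    \prod_(o <- x) step_weight f (y N) o.
  pose g (x : N.+1.-tuple (option ('I_n * 'I_m.+1))) : R :=
    #|state fits zone x|%:R.
  have psum : \sum_x p x = rho N 0 ^+ N.+1.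
    have := sum_histories (y N) N.+1 jump_sum1; rewrite mulr1 => <-.
    by apply: eq_bigr => x _; rewrite mulr1.
  have gsum : \sum_x g x * p x = low N.
    rewrite /low -psum mulr_sumr.
    have -> : \sum_(j <- r) rho N (s j) ^+ N.+1 * v j finset.set0 =
        \sum_(j <- r) \sum_x p x * v j (state fits zone x).
      rewrite big_seq [RHS]big_seq; apply: eq_bigr => j jr.
      by rewrite (@sum_histories _ m f n fits zone (v j) (y N) (s j))// => A;
        exact: veig.
    rewrite exchange_big/= -sumrB; apply: eq_bigr => x _.
    by rewrite -mulr_sumr vsum /g; ring.
  rewrite -gsum /high -gsum -psum.
  apply: (@integral_sandwich _ _ _ P _ E).
  - by move=> x; exact: (measurable_history_event hTB h0).
  - by move=> x; exact: (history_event_prob hlambda hTB h0).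
  - move=> x x' w Ex Ex'; apply: val_inj.
    by apply: history_event_inj Ex Ex'; rewrite !size_tuple.
  - move=> x w Ex.
    suff -> : picked T B fits zone t w = state fits zone x by [].
    have -> : t = u (size x).
      by rewrite size_tuple /u mulrC divfK// pnatr_eq0.
    apply: (picked_history _ _ _ _ _ fits zone Ex).
    + by move=> i j w'; case: (model_times hTB i).
    + by move=> i j w'; case: (model_times hTB i).
    + by move=> i w'; case: (model_times hTB i).
    + by rewrite /u mul0r.
    + by move=> l; rewrite /u ler_pM2r// ler_nat.
  - by move=> x; rewrite ler0n.
  - by move=> w; rewrite ler0n ler_nat -[leqRHS]card_ord max_card.
have rho_lim b : b <= n%:R ->
    rho N b ^+ N.+1 @[N --> \oo] --> expR (- (lambda * b * t)).
  move=> bn; have lt0 : 0 <= lambda * t by rewrite mulr_ge0// ltW.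
  have := cvg_step_factor lt0 (_ : 0 <= n%:R - b).
  rewrite subr_ge0 => /(_ bn); rewrite (_ : b * (lambda * t) = lambda * b * t).
    by rewrite /rho /y; under eq_fun do rewrite -mulrA.
  by ring.
set L := (X in _ = X%:E).
have rho0_lim : rho N 0 ^+ N.+1 @[N --> \oo] --> (1 : R).
  by have := rho_lim 0 (ler0n _ _); rewrite mulr0 mul0r oppr0 expR0.
have sum_lim : \sum_(j <- r) rho N (s j) ^+ N.+1 * v j finset.set0 @[N --> \oo] -->
    \sum_(j <- r) v j finset.set0 * expR (- (lambda * s j * t)).
  elim: r sn {vsum veig low high L bounds} => [|j r IH] sn.
    by rewrite big_nil; under eq_fun do rewrite big_nil; exact: cvg_cst.
  rewrite big_cons; under eq_fun do rewrite big_cons.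
  apply: cvgD; last by apply: IH => i ir; apply: sn; rewrite inE ir orbT.
  rewrite mulrC; apply: cvgM; last exact: cvg_cst.
  by apply: rho_lim; apply: sn; rewrite inE eqxx.
have low_lim : low N @[N --> \oo] --> L.
  rewrite /L -[n%:R]mulr1; apply: cvgB; last exact: sum_lim.
  by apply: cvgM; [exact: cvg_cst|exact: rho0_lim].
have high_lim : high N @[N --> \oo] --> L.
  rewrite -[L]addr0 -(mulr0 n%:R) -(subrr 1); apply: cvgD => //.
  apply: cvgM; first exact: cvg_cst.
  by apply: cvgB; [exact: cvg_cst|exact: rho0_lim].
move: bounds; case: (\int[P]_w _)%E => [I| |] bounds; last 2 first.
- by have := bounds 0%N; rewrite leye_eq andbF.
- by have := bounds 0%N; rewrite leeNy_eq.
have IL : (fun=> I) @ \oo --> L.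
  apply: squeeze_cvgr low_lim high_lim; apply: nearW => N.
  by have := bounds N; rewrite !lee_fin.
by congr (_%:E); rewrite -(cvg_lim (@Rhausdorff R) IL) lim_cst.
Qed.

End picked_expectation.

(** * The expected numbers of packages on the line and on the circle *)

Theorem proposition3p2 (R : realType) (m : nat) (hm : (1 <= m)%N)
    (f : nat -> R) (hf : is_size_pmf m f)
    (gamma : nat -> nat -> R) (hgamma : is_gamma (size_cdf f) gamma)
    (lambda t : R) (hlambda : 0 < lambda) (ht : 0 <= t)
    (n : nat) (hn : (1 <= n)%N)
    (d : measure_display) (Omega : measurableType d) (P : probability Omega R)
    (T : 'I_n -> nat -> {RV P >-> R}) (B : 'I_n -> nat -> {RV P >-> nat})
    (hTB : request_model lambda f T B) :
  line_R P T B t =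
    (if 0 < \sum_(1 <= j < n.+1) size_cdf f j then
       \sum_(1 <= i < n.+1) gamma n i *
         expR (- (lambda * (\sum_(1 <= j < i.+1) size_cdf f j) * t))
     else n%:R)%:E
  /\
  ((m <= n)%N ->
   circle_C P T B t =
    (n%:R
     - \sum_(1 <= i < n) gamma_circle f gamma n i *
         expR (- (lambda * (\sum_(1 <= j < i.+1) size_cdf f j) * t))
     - gamma_circle f gamma n n * expR (- (lambda * n%:R * t)))%:E).
Proof.
case: n hn T B hTB => // n' _ {}T {}B {}hTB.
split=> [|mn].
- rewrite /line_R /line_K (expected_picked_eigen hlambda hTB hf ht
    (r := index_iota 1 n'.+2) (s := exponent f)
    (v := fun j => line_val gamma (n := n') j)).
  + rewrite -EFinB subKr; congr (_%:E).
    case: ifPn => [_|]; last rewrite -leNgt => S0.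
      rewrite big_nat [RHS]big_nat; apply: eq_bigr => j jn.
      by rewrite line_val0.
    (* All the rates vanish, so the sum keeps its initial value n. *)
    rewrite -[RHS](subr0) -[X in _ - X](_ : #|finset.set0 : {set 'I_n'.+1}|%:R = 0);
      last by rewrite cards0.
    rewrite -(line_val_sum hgamma) big_nat [RHS]big_nat.
    apply: eq_bigr => j /andP[j1 jn].
    suff -> : exponent f j = 0 by rewrite mulr0 mul0r oppr0 expR0 mulr1.
    apply/eqP; rewrite eq_le (exponent_ge0 hf) andbT (le_trans _ S0)//.
    rewrite [leRHS](big_cat_nat (n := j.+1))//= lerDl.
    by apply: sumr_ge0 => a _; exact: size_cdf_ge0 hf _.
  + by move=> A; exact: (line_val_sum hgamma).
  + move=> j A; rewrite mem_index_iota => /andP[j1 _].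
    exact: (line_val_eigen hf hgamma _ j1).
  + move=> j; rewrite mem_index_iota => /andP[_ jn].
    by rewrite (le_trans (exponent_le hf j))// ler_nat.
- rewrite /circle_C (expected_picked_eigen hlambda hTB hf ht
    (r := index_iota 1 n'.+2) (s := circle_rate f n')
    (v := fun j => circle_val f gamma (n := n') j)).
  + congr (_%:E); rewrite big_nat_recr//= opprD addrA; congr (_ - _ - _).
      rewrite big_nat [RHS]big_nat; apply: eq_bigr => j /andP[_ jn].
      by rewrite circle_val0 /circle_rate ltn_eqF.
    by rewrite circle_val0 /circle_rate eqxx.
  + by move=> A; exact: (circle_val_sum hgamma).
  + move=> j A; rewrite mem_index_iota => jn.
    apply: (circle_val_eigen hf hgamma _ jn mn).
  + move=> j; rewrite mem_index_iota /circle_rate => /andP[_ jn].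
    case: eqP => // _.
    by rewrite (le_trans (exponent_le hf j))// ler_nat.
Qed.
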